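(* Let $n\ge 1$ and $A\in M_n(\mathbb{Z})$. Suppose that $\mu$ is a $\times A$-invariant Borel probability measure on $\mathbb{T}^n$ satisfying one of the following: (1) $\mu$ is ergodic (for $T_A$) and there exist an $n$-tuple $(B_1,\dots,B_n)$ of matrices in $M_n(\mathbb{Z})$ strongly independent over $\mathbb{Q}$ and a Følner sequence $\Sigma=\{F_m\}_{m=1}^\infty$ in $\mathbb{N}$ such that $\mu$ is $\times(A^j+B_i)$-invariant for all $j$ in some set $E\subseteq\mathbb{N}$ with $\overline{D}_\Sigma(E)=1$ and all $i=1,\dots,n$; (2) $\mu$ is weakly mixing (for $T_A$) and there exist an $n$-tuple $(B_1,\dots,B_n)$ of matrices in $M_n(\mathbb{Z})$ strongly independent over $\mathbb{Q}$ and a Følner sequence $\Sigma=\{F_m\}_{m=1}^\infty$ in $\mathbb{N}$ such that $\mu$ is $\times(A^j+B_i)$-invariant for all $j$ in some set $E\subseteq\mathbb{N}$ with $\overline{D}_\Sigma(E)>0$ and all $i=1,\dots,n$; (3) $\mu$ is strongly mixing (for $T_A$) and there exist an $n$-tuple $(B_1,\dots,B_n)$ of matrices in $M_n(\mathbb{Z})$ strongly independent over $\mathbb{Q}$ and an infinite set $E\subseteq\mathbb{N}$ such that $\mu$ is $\times(A^j+B_i)$-invariant for all $j\in E$ and all $i=1,\dots,n$. Then $\mu$ is either finitely supported or the Lebesgue (Haar) measure on $\mathbb{T}^n$. Moreover, a $\times A$-invariant Borel probability measure satisfying (2) or (3) is either a Dirac measure or the Lebesgue measure.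
   Context: $\mathbb{N}=\{0,1,2,\dots\}$ and $A^0=I_n$. Identify $\mathbb{T}^n=\{(z_1,\dots,z_n)\in\mathbb{C}^n:|z_i|=1\}$ with $\mathbb{R}^n/\mathbb{Z}^n$ via $(x_1,\dots,x_n)+\mathbb{Z}^n\mapsto(e^{2\pi i x_1},\dots,e^{2\pi i x_n})$. For $C\in M_n(\mathbb{Z})$, the map $T_C:\mathbb{R}^n/\mathbb{Z}^n\to\mathbb{R}^n/\mathbb{Z}^n$ is $T_C(x+\mathbb{Z}^n)=xC+\mathbb{Z}^n$ for row vectors $x\in\mathbb{R}^n$; a Borel probability measure $\mu$ is $\times C$-invariant if $\mu(T_C^{-1}F)=\mu(F)$ for all Borel $F$. A $T$-invariant $\mu$ is ergodic if every Borel $F$ with $T^{-1}F=F$ has $\mu(F)\in\{0,1\}$; weakly mixing if $\mu\times\mu$ is ergodic for $T\times T$; strongly mixing if $\lim_{j\to\infty}\mu(T^{-j}F\cap G)=\mu(F)\mu(G)$ for all Borel $F,G$. A Følner sequence in $\mathbb{N}$ is a sequence $\{F_m\}$ of nonempty finite subsets of $\mathbb{N}$ with $\lim_{m\to\infty}|(F_m+m')\,\Delta\,F_m|/|F_m|=0$ for every $m'\in\mathbb{N}$. For $E\subseteq\mathbb{N}$, $\overline{D}_\Sigma(E)=\limsup_{m\to\infty}|E\cap F_m|/|F_m|$. An $n$-tuple $(B_1,\dots,B_n)$ of $n\times n$ matrices with rational (here integer) entries is strongly independent over $\mathbb{Q}$ if for every nonzero $v\in\mathbb{Q}^{n\times 1}$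 the vectors $B_1v,\dots,B_nv$ are linearly independent over $\mathbb{Q}$. *)

(* Defs.v *)
From HB Require Import structures.
From mathcomp Require Import all_boot all_order all_algebra.
From mathcomp Require Import finmap.
From mathcomp Require Import all_classical all_reals all_analysis.
Set Implicit Arguments.
Unset Strict Implicit.
Unset Printing Implicit Defensive.
Import Order.TTheory GRing.Theory Num.Theory.
Import numFieldNormedType.Exports.
Local Open Scope classical_set_scope.
Local Open Scope ring_scope.

(* Points of the torus are represented by row vectors x : 'rV[R]_n,    *)
(* two vectors representing the same point iff they differ by an       *)
(* integer vector.  A subset of T^n is the same thing as a Z^n-periodic *)
(* subset of R^n (its preimage under the quotient map).  Open sets of   *)
(* T^n (quotient topology) are exactly the Z^n-periodic open subsets of *)
(* R^n, and the Borel sigma-algebra of T^n is the sigma-algebra they    *)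
(* generate.                                                           *)

Definition intvec (R : realType) (n : nat) (k : 'rV[int]_n) : 'rV[R]_n :=
  map_mx (fun z : int => z%:~R) k.

Definition Zn_periodic (R : realType) (n : nat) (A : set 'rV[R]_n) : Prop :=
  forall (x : 'rV[R]_n) (k : 'rV[int]_n), A x -> A (x + @intvec R n k).

Definition torus_open (R : realType) (n : nat) : set (set 'rV[R]_n) :=
  [set A | open A /\ Zn_periodic A].

Definition torus (R : realType) (n : nat) := g_sigma_algebraType (@torus_open R n).

(* the image of a subset S of R^n in T^n, as a periodic set *)
Definition Zn_hull (R : realType) (n : nat) (S : set 'rV[R]_n) : set 'rV[R]_n :=
  [set x + @intvec R n k | x in S & k in [set: 'rV[int]_n]].

Definition Tmap (R : realType) (n : nat) (C : 'M[int]_n) (x : torus R n) : torus R n :=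
  (x : 'rV[R]_n) *m map_mx (fun z : int => z%:~R) C.

Definition invariant d (T : measurableType d) (R : realType)
  (mu : set T -> \bar R) (f : T -> T) : Prop :=
  forall F : set T, measurable F -> mu (f @^-1` F) = mu F.

Definition timesC_invariant (R : realType) (n : nat) (C : 'M[int]_n)
  (mu : probability (torus R n) R) : Prop :=
  invariant mu (Tmap C).

Definition ergodic d (T : measurableType d) (R : realType)
  (mu : set T -> \bar R) (f : T -> T) : Prop :=
  forall F : set T, measurable F -> f @^-1` F = F ->
    mu F = 0%E \/ mu F = 1%E.

Definition weakly_mixing d (T : measurableType d) (R : realType)
  (mu : probability T R) (f : T -> T) : Prop :=
  ergodic (mu \x mu)%E (fun p : T * T => (f p.1, f p.2)).

Definition strongly_mixing d (T : measurableType d) (R : realType)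
  (mu : probability T R) (f : T -> T) : Prop :=
  forall F G : set T, measurable F -> measurable G ->
    (fun j : nat => mu (iter j f @^-1` F `&` G)) @ \oo --> (mu F * mu G)%E.

Definition fshift (A : {fset nat}) (k : nat) : {fset nat} :=
  [fset (x + k)%N | x in A]%fset.

Definition fsymdiff (A B : {fset nat}) : {fset nat} :=
  fsetU (fsetD A B) (fsetD B A).

Definition folner (R : realType) (F : nat -> {fset nat}) : Prop :=
  (forall m, F m != fset0) /\
  forall k : nat,
    (fun m => (#|` fsymdiff (fshift (F m) k) (F m) |)%:R
              / (#|` F m |)%:R : R) @ \oo --> (0 : R).

Definition upper_density (R : realType) (F : nat -> {fset nat}) (E : set nat) : R :=
  limn_sup (fun m => (#|` [fset x in F m | `[< E x >]]%fset |)%:R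
                     / (#|` F m |)%:R : R).

Definition ratmx (n : nat) (M : 'M[int]_n) : 'M[rat]_n :=
  map_mx (fun z : int => z%:~R) M.

Definition strongly_independent (n : nat) (B : 'I_n -> 'M[int]_n) : Prop :=
  forall v : 'cV[rat]_n, v != 0 ->
    forall c : 'I_n -> rat,
      \sum_(i < n) c i *: (ratmx (B i) *m v) = 0 -> forall i, c i = 0.

Definition finitely_supported (R : realType) (n : nat)
  (mu : probability (torus R n) R) : Prop :=
  exists S : set 'rV[R]_n, finite_set S /\ mu (Zn_hull S) = 1%E.

Definition is_dirac (R : realType) (n : nat) (mu : probability (torus R n) R) : Prop :=
  exists a : torus R n, forall F : set (torus R n), measurable F ->
    mu F = \d_a F.

(* the Lebesgue = normalized Haar measure on T^n: the translation
   invariant Borel probability measure *)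
Definition is_haar (R : realType) (n : nat) (mu : probability (torus R n) R) : Prop :=
  forall (t : 'rV[R]_n) (F : set (torus R n)), measurable F ->
    mu ((fun x : torus R n => (x : 'rV[R]_n) + t : torus R n) @^-1` F) = mu F.

(* Main.v *)
(* Write muhat(v) for the integral of e(x.v), so that muhat(C v) = muhat(v) when
   mu is invariant under C. For j in E this reads muhat(A^j v + B_i v) = muhat(v),
   and the left side is the j-th correlation of the characters v and B_i v under
   T_A. Letting j run through E, each mixing hypothesis (the mean ergodic theorem
   along the Folner sequence in case (1), applied to the product system in case
   (2)) gives muhat(v) muhat(B_i v) = muhat(v). If muhat vanishes off 0, mu is the
   Haar measure, because indicators of open sets are iterated bounded limits of
   trigonometric polynomials. Otherwise some v <> 0 has muhat(B_i v) = 1 for all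
   i, so that x.(B_i v) is an integer for almost every x, and as the B_i v are
   linearly independent mu lives on the finitely many points of order dividing d,
   d = det(B_1 v, ..., B_n v). Then muhat is d-periodic, and mixing along the
   sequence A^j v mod d, which takes finitely many values, gives |muhat| = 1. *)
Require Import Defs.
From HB Require Import structures.
From mathcomp Require Import all_boot all_order all_algebra.
From mathcomp Require Import finmap.
From mathcomp Require Import all_classical all_reals all_analysis.
From mathcomp Require Import measurable_realfun ring lra.
Set Implicit Arguments.
Unset Strict Implicit.
Unset Printing Implicit Defensive.
Import Order.TTheory GRing.Theory Num.Theory.
Import numFieldNormedType.Exports.
Local Open Scope classical_set_scope.
Local Open Scope ring_scope.

(** * Averages and bounded random variables *)

Section Average.
Context {R : realType}.
Implicit Types (F : {fset nat}) (s t : nat -> R).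

(** The hypotheses on [E] match what each kind of mixing controls. Ergodicity gives only plain
    averages of correlations, so the invariance must hold on a full share of the indices. Weak
    mixing makes the squared deviations average to 0, which excludes any other constant value on a
    set of positive upper density. Strong mixing takes the same mean-square form once averages are
    taken over singletons of [E]. The classification is therefore done once, for an abstract notion
    of limit. Everything is real: a character is a cosine and a sine, and muhat a pair of
    expectations. The mean ergodic theorem is proved without the space L2: functions are defined and
    bounded at every point, and near-minimisers of the second moment are chosen so fast that they
    converge almost everywhere. Mean-square limits are also what decides between a Dirac measure and
    a finite support: each of the finitely many residues has its own limit, and one of these limits
    must be 1. *)

Definition average F s : R := (\sum_(j <- F) s j) / #|` F|%:R.

Lemma averageD F s t :
  average F (fun j => s j + t j) = average F s + average F t.
Proof. by rewrite /average big_split mulrDl. Qed.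

Lemma averageZ F a s : average F (fun j => a * s j) = a * average F s.
Proof. by rewrite /average -mulr_sumr mulrA. Qed.

Lemma averageB F s t :
  average F (fun j => s j - t j) = average F s - average F t.
Proof.
rewrite -[- average F t]mulN1r -averageZ -averageD.
by congr average; apply/funext => j; rewrite mulN1r.
Qed.

Lemma average_cst F (a : R) : F != fset0 -> average F (fun=> a) = a.
Proof.
move=> F0; rewrite /average big_const_seq count_predT iter_addr addr0.
by rewrite -[a *+ _]mulr_natr mulfK// pnatr_eq0 cardfs_eq0.
Qed.

Lemma ler_average F s t : (forall j, s j <= t j) -> average F s <= average F t.
Proof.
by move=> st; rewrite /average ler_wpM2r ?invr_ge0 ?ler0n// ler_sum.
Qed.

Lemma ler_norm_average F s (C : R) : F != fset0 ->
  (forall j, `|s j| <= C) -> `|average F s| <= C.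
Proof.
move=> F0 sC; rewrite ler_norml -{1}(average_cst (- C) F0).
rewrite -{2}(average_cst C F0).
by apply/andP; split; apply: ler_average => j; have := sC j; rewrite ler_norml => /andP[].
Qed.

(** The shifted sum is a sum over [F + 1]; the common indices cancel and only the symmetric
    difference is left. The Følner condition enters through this bound. *)
Lemma average_shift F s (C : R) : (forall j, `|s j| <= C) ->
  `|average F (fun j => s j.+1) - average F s| <=
  C * (#|` fsymdiff (fshift F 1) F |%:R / #|` F|%:R).
Proof.
move=> sC; rewrite /average -mulrBl normrM [X in _ * X <= _]ger0_norm ?invr_ge0//.
rewrite mulrA ler_wpM2r ?invr_ge0//.
set A := fshift F 1.
have -> : \sum_(j <- F) s j.+1 = \sum_(j <- A) s j.
  rewrite /A /fshift big_imfset/=; last by move=> x y _ _ /addIn.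
  by apply: eq_bigr => j _; rewrite addn1.
have split_sum (U V : {fset nat}) :
    \sum_(j <- U) s j = \sum_(j <- (U `&` V)%fset) s j + \sum_(j <- (U `\` V)%fset) s j.
  rewrite (big_fsetID _ (mem V))/=; congr (_ + _); apply: eq_fbig => // j;
    by rewrite !inE// andbC.
rewrite (split_sum A F) (split_sum F A) fsetIC.
have sum_bound (U : {fset nat}) : `|\sum_(j <- U) s j| <= C * #|` U|%:R.
  apply: (le_trans (ler_norm_sum _ _ _)).
  apply: (@le_trans _ _ (\sum_(j <- U) C)); first by apply: ler_sum => j _.
  by rewrite big_const_seq count_predT iter_addr addr0 mulr_natr.
rewrite [X in `|X| <= _](_ : _ = \sum_(j <- (A `\` F)%fset) s j -
    \sum_(j <- (F `\` A)%fset) s j); last by ring.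
rewrite (le_trans (ler_normB _ _))//.
rewrite (le_trans (lerD (sum_bound _) (sum_bound _)))// -mulrDr -natrD.
rewrite /fsymdiff cardfsU.
suff -> : ((A `\` F) `&` (F `\` A))%fset = fset0 by rewrite cardfs0 subn0.
by apply/fsetP => x; rewrite !inE; case: (x \in A); rewrite ?andbF.
Qed.

End Average.

Section BoundedMeasurable.
Context d (X : measurableType d) (R : realType).
Implicit Types (f g : X -> R).

(** The bound holds everywhere, not almost everywhere: the class then mentions no measure, is closed
    under products and under composition with measurable maps, and is integrable for every
    probability, product measures included. *)
Definition bounded_measurable f :=
  measurable_fun setT f /\ exists M, forall x, `|f x| <= M.

Lemma bmf_cst (a : R) : bounded_measurable (fun=> a).
Proof. by split; [exact: measurable_cst|exists `|a|]. Qed.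

Lemma bmfD f g : bounded_measurable f -> bounded_measurable g ->
  bounded_measurable (fun x => f x + g x).
Proof.
move=> [mf [M fM]] [mg [N gN]]; split; first exact: measurable_funD.
by exists (M + N) => x; rewrite (le_trans (ler_normD _ _))// lerD.
Qed.

Lemma bmfM f g : bounded_measurable f -> bounded_measurable g ->
  bounded_measurable (fun x => f x * g x).
Proof.
move=> [mf [M fM]] [mg [N gN]]; split; first exact: measurable_funM.
by exists (M * N) => x; rewrite normrM ler_pM.
Qed.

Lemma bmfZ (a : R) f : bounded_measurable f ->
  bounded_measurable (fun x => a * f x).
Proof. exact: bmfM (bmf_cst a). Qed.

Lemma bmfB f g : bounded_measurable f -> bounded_measurable g ->
  bounded_measurable (fun x => f x - g x).
Proof.
move=> [mf [M fM]] [mg [N gN]]; split; first exact: measurable_funB.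
by exists (M + N) => x; rewrite (le_trans (ler_normB _ _))// lerD.
Qed.

Lemma bmf_norm f : bounded_measurable f -> bounded_measurable (fun x => `|f x|).
Proof.
move=> [mf [M fM]]; split; first exact: measurableT_comp.
by exists M => x; rewrite normr_id.
Qed.

Lemma bmf_comp (T : X -> X) f : measurable_fun setT T ->
  bounded_measurable f -> bounded_measurable (f \o T).
Proof.
move=> mT [mf [M fM]]; split; first exact: measurableT_comp.
by exists M => x /=.
Qed.

Lemma bmf_indic (A : set X) : measurable A -> bounded_measurable (\1_A).
Proof.
move=> mA; split=> //; exists 1 => x; rewrite indicE.
by case: (_ \in _); rewrite ?normr1 ?normr0.
Qed.

Lemma measurable_iter (T : X -> X) j :
  measurable_fun setT T -> measurable_fun setT (iter j T).
Proof.
move=> mT; elim: j => [|j IH] /=; first exact: measurable_id.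
exact: measurableT_comp.
Qed.

End BoundedMeasurable.

Section Expectation.
Context d (X : measurableType d) (R : realType) (P : probability X R).
Implicit Types (f g : X -> R).
Local Notation bmf := (@bounded_measurable d X R).

Definition expect f : R := Rintegral P setT f.

Lemma bmf_integrable f : bmf f -> P.-integrable setT (EFin \o f).
Proof.
move=> [mf [M fM]]; apply: measurable_bounded_integrable => //.
  by rewrite (le_lt_trans (probability_le1 P _))// ltry.
exists M; split; first exact: num_real.
by move=> y My x _; exact: le_trans (fM x) (ltW My).
Qed.

Lemma expect_cst (a : R) : expect (fun=> a) = a.
Proof. by rewrite /expect Rintegral_cst// [X in fine X](probability_setT P) mulr1. Qed.

Lemma expectD f g : bmf f -> bmf g ->
  expect (fun x => f x + g x) = expect f + expect g.
Proof. by move=> bf bg; apply: RintegralD => //; exact: bmf_integrable. Qed.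

Lemma expectB f g : bmf f -> bmf g ->
  expect (fun x => f x - g x) = expect f - expect g.
Proof. by move=> bf bg; apply: RintegralB => //; exact: bmf_integrable. Qed.

Lemma expectZ (a : R) f : bmf f -> expect (fun x => a * f x) = a * expect f.
Proof. by move=> bf; apply: RintegralZl => //; exact: bmf_integrable. Qed.

Lemma expect_ge0 f : (forall x, 0 <= f x) -> 0 <= expect f.
Proof. by move=> f0; apply: Rintegral_ge0. Qed.

Lemma ler_expect f g : bmf f -> bmf g -> (forall x, f x <= g x) ->
  expect f <= expect g.
Proof. by move=> bf bg fg; apply: le_Rintegral => //; exact: bmf_integrable. Qed.

Lemma ler_norm_expect f : bmf f -> `|expect f| <= expect (fun x => `|f x|).
Proof. by move=> bf; apply: le_normr_Rintegral => //; exact: bmf_integrable. Qed.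

Lemma expectE f : bmf f -> (expect f)%:E = (\int[P]_x (f x)%:E)%E.
Proof.
by move=> bf; rewrite /expect /Rintegral fineK//; apply: integrable_fin_num => //;
  exact: bmf_integrable.
Qed.

Lemma expect_ae f g : bmf f -> bmf g -> {ae P, forall x, f x = g x} ->
  expect f = expect g.
Proof.
move=> bf bg fg; apply: EFin_inj; rewrite !expectE//.
apply: ae_eq_integral => //.
- by apply/measurable_EFinP; case: bf.
- by apply/measurable_EFinP; case: bg.
- by apply: filterS fg => x -> _.
Qed.

Lemma expect_invariant (T : X -> X) f : measurable_fun setT T ->
  Defs.invariant P T -> bmf f -> expect (f \o T) = expect f.
Proof.
move=> mT iT bf; rewrite /expect /Rintegral; congr fine.
have mf : measurable_fun setT (EFin \o f) by apply/measurable_EFinP; case: bf.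
have := @integral_pushforward _ _ _ _ R T mT P setT (EFin \o f) mf.
rewrite preimage_setT => /(_ _ measurableT) <-; last first.
  by apply: (@bmf_integrable (f \o T)); exact: bmf_comp.
by apply: eq_measure_integral => A mA _; exact: iT.
Qed.

Lemma expect_eq0 f : bmf f -> (forall x, 0 <= f x) -> expect f = 0 ->
  {ae P, forall x, f x = 0}.
Proof.
move=> bf f0 Ef; have mf : measurable_fun setT (EFin \o f).
  by apply/measurable_EFinP; case: bf.
have /(ae_eq_integral_abs P measurableT mf) : (\int[P]_x `|(EFin \o f) x| = 0)%E.
  under eq_integral do rewrite /= ger0_norm//.
  by rewrite -expectE// Ef.
by apply: filterS => x /= /(_ I)[].
Qed.

End Expectation.

(** * The mean ergodic theorem along Folner sequences *)

Section AlmostEverywhere.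
Context d (X : measurableType d) (R : realType) (P : probability X R).
Implicit Types (f g : X -> R).
Local Notation bmf := (@bounded_measurable d X R).

Lemma prob0_ae (A : set X) : measurable A -> P A = 0%E ->
  {ae P, forall x, ~ A x}.
Proof. by move=> mA PA; exists A; split=> // x /= /contrapT. Qed.

Lemma ae_prob0 (A : set X) : measurable A -> {ae P, forall x, ~ A x} ->
  P A = 0%E.
Proof.
move=> mA [N [mN PN AN]]; apply: (subset_measure0 mA mN _ PN) => x Ax.
by apply: AN => /=; apply.
Qed.

Lemma prob1_ae (A : set X) : measurable A -> P A = 1%E ->
  {ae P, forall x, A x}.
Proof.
move=> mA PA; have /prob0_ae : P (~` A) = 0%E by rewrite probability_setC// PA subee.
by move=> /(_ (measurableC mA)); apply: filterS => x /contrapT.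
Qed.

Lemma ae_prob1 (A : set X) : measurable A -> {ae P, forall x, A x} ->
  P A = 1%E.
Proof.
move=> mA aeA; rewrite -[A]setCK probability_setC ?ae_prob0 ?sube0//.
- exact: measurableC.
- by apply: filterS aeA => x Ax; apply.
- exact: measurableC.
Qed.

Lemma prob_ae_eq (A B : set X) : measurable A -> measurable B ->
  {ae P, forall x, A x <-> B x} -> P A = P B.
Proof.
move=> mA mB AB; have := @ae_eq_integral _ _ _ P setT (EFin \o \1_B) (EFin \o \1_A).
rewrite !integral_indic// !setIT; apply => //.
- exact/measurable_EFinP.
- exact/measurable_EFinP.
- apply: filterS AB => x AB _ /=; rewrite !indicE.
  by rewrite (_ : (x \in A) = (x \in B))//; apply/idP/idP => /set_mem /AB /mem_set.
Qed.

Lemma ae_comp (T : X -> X) (Q : X -> Prop) : measurable_fun setT T ->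
  Defs.invariant P T -> {ae P, forall x, Q x} -> {ae P, forall x, Q (T x)}.
Proof.
move=> mT iT [N [mN PN QN]]; exists (T @^-1` N); split.
- by rewrite -[_ @^-1` _]setTI; exact: mT.
- by rewrite iT.
- by move=> x /= nQ; exact: QN.
Qed.

Lemma ae_forall_ord (n : nat) (Q : 'I_n -> X -> Prop) :
  (forall i, {ae P, forall x, Q i x}) -> {ae P, forall x, forall i, Q i x}.
Proof.
move=> Qae.
have : {ae P, forall x, forall m : nat, forall i : 'I_n, i = m :> nat -> Q i x}.
  apply: ae_foralln => m; have [mn|nm] := ltnP m n.
    apply: filterS (Qae (Ordinal mn)) => x Qx i im.
    by rewrite (_ : i = Ordinal mn)//; exact: val_inj.
  by apply: aeW => x i im; have := ltn_ord i; rewrite im ltnNge nm.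
by apply: filterS => x Qx i; exact: (Qx i i).
Qed.

Lemma ae_exists (Q : X -> Prop) : {ae P, forall x, Q x} -> exists x, Q x.
Proof.
move=> Qae; apply: contrapT => /forallNP nQ.
have : P setT = 0%E by apply: ae_prob0 => //; apply: filterS Qae => x /nQ.
by rewrite probability_setT => /eqP; rewrite onee_eq0.
Qed.

Lemma ler_expect_ae f g : bmf f -> bmf g -> {ae P, forall x, f x <= g x} ->
  expect P f <= expect P g.
Proof.
move=> bf bg fg; rewrite -subr_ge0 -expectB//.
rewrite (@expect_ae _ _ _ _ _ (fun x => `|g x - f x|)); first exact: expect_ge0.
- exact: bmfB.
- exact/bmf_norm/bmfB.
- by apply: filterS fg => x fgx; rewrite ger0_norm// subr_ge0.
Qed.

Lemma ergodic_ae_cst (T : X -> X) (f : X -> R) :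
  measurable_fun setT T -> Defs.invariant P T -> ergodic P T -> bmf f ->
  {ae P, forall x, f (T x) = f x} -> exists c, {ae P, forall x, f x = c}.
Proof.
move=> mT iT eT bf fT; pose c := expect P f.
have mf : measurable_fun setT f by case: bf.
have orbit : {ae P, forall x, forall j, f (iter j T x) = f x}.
  apply: ae_foralln; elim=> [|j IH]; first exact: aeW.
  have := ae_comp mT iT IH; apply: filterS2 fT => x fTx.
  by rewrite -iterSr fTx.
have mgt (h : X -> R) q : measurable_fun setT h -> measurable [set x | q < h x].
  move=> mh; rewrite (_ : [set _ | _] = setT `&` h @^-1` `]q, +oo[%classic).
    by apply: mh => //; exact: measurable_itv.
  by apply/seteqP; split => x /=; rewrite in_itv/= andbT// => -[].
have zero_one q : P [set x | q < f x] = 0%E \/ P [set x | q < f x] = 1%E.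
  (* The limsup of the preimages of the level set is strictly invariant, and on almost every orbit
     [f] is constant, so it agrees with the level set almost everywhere. *)
  pose E := \bigcap_n \bigcup_(j >= n) [set x | q < f (iter j T x)].
  have mE : measurable E.
    apply: bigcapT_measurable => n; apply: bigcup_measurable => j _.
    by apply: mgt; apply: (measurableT_comp mf); exact: measurable_iter.
  have -> : P [set x | q < f x] = P E.
    apply: prob_ae_eq => //; first exact: mgt.
    apply: filterS orbit => x fx; split=> [qx n _|/(_ 0%N I)[j _ /=]].
      by exists n => //=; rewrite fx.
    by rewrite fx.
  apply: eT => //; apply/seteqP; split=> x Ex n _.
    have [j nj /= qj] := Ex n I; exists j.+1; first exact: leqW.
    by rewrite /= -iterS iterSr.
  have [[//|j] nj /= qj] := Ex n.+1 I; exists j => //.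
  by rewrite /= -iterSr iterS.
(* If the level set were null, [f <= q] almost everywhere would give [c <= q]. *)
have lt_c q : q < c -> {ae P, forall x, q < f x}.
  move=> qc; have [P0|P1] := zero_one q; last first.
    by apply: (prob1_ae _ P1); exact: mgt.
  have := prob0_ae (mgt _ _ mf) P0 => fq.
  suff : c <= q by rewrite leNgt qc.
  rewrite -(expect_cst P q); apply: ler_expect_ae => //; first exact: bmf_cst.
  by apply: filterS fq => x /negP; rewrite -leNgt.
have gt_c q : c < q -> {ae P, forall x, f x <= q}.
  move=> qc; have [P0|P1] := zero_one q.
    apply: filterS (prob0_ae (mgt _ _ mf) P0) => x /negP.
    by rewrite -leNgt.
  have := prob1_ae (mgt _ _ mf) P1 => fq.
  suff : q <= c by rewrite leNgt qc.
  rewrite -(expect_cst P q); apply: ler_expect_ae => //; first exact: bmf_cst.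
  by apply: filterS fq => x /ltW.
exists c.
have all_lt : {ae P, forall x, forall k : nat, c - k.+1%:R^-1 < f x}.
  by apply: ae_foralln => k; apply: lt_c; rewrite ltrBlDr ltrDl invr_gt0.
have all_gt : {ae P, forall x, forall k : nat, f x <= c + k.+1%:R^-1}.
  by apply: ae_foralln => k; apply: gt_c; rewrite ltrDl invr_gt0.
apply: filterS2 all_lt all_gt => x cl cg; apply/eqP; rewrite eq_le.
apply/andP; split; apply/ler_addgt0Pr => e e0.
  apply: (le_trans (cg (Num.truncn e^-1))); rewrite lerD2l.
  by rewrite -[leRHS]invrK lef_pV2 ?posrE ?invr_gt0// ltW// truncnS_gt.
rewrite -lerBlDr; apply/ltW/(le_lt_trans _ (cl (Num.truncn e^-1))).
rewrite lerD2l lerN2.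
by rewrite -[leRHS]invrK lef_pV2 ?posrE ?invr_gt0// ltW// truncnS_gt.
Qed.

End AlmostEverywhere.

Lemma eq_ler (R : numDomainType) (x y : R) : x = y -> x <= y.
Proof. by move=> ->. Qed.

Section Summable.
Context d (X : measurableType d) (R : realType) (P : probability X R).
Local Notation bmf := (@bounded_measurable d X R).

Lemma half_series_le (C : R) (m : nat) : 0 <= C ->
  \sum_(0 <= i < m) C * (2^-1) ^+ i <= 2 * C.
Proof.
move=> C0; suff -> : \sum_(0 <= i < m) C * (2^-1) ^+ i = 2 * C - 2 * C * (2^-1) ^+ m.
  by rewrite gerBl mulr_ge0 ?exprn_ge0 ?mulr_ge0.
elim: m => [|m IH]; first by rewrite big_geq// expr0 mulr1 subrr.
by rewrite big_nat_recr//= IH exprS; field.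
Qed.

(** By monotone convergence the sum of the series has integral at most 2C, hence is finite almost
    everywhere. *)
Lemma ae_cvg_series (w : nat -> X -> R) (C : R) :
  (forall i, bmf (w i)) -> (forall i x, 0 <= w i x) ->
  (forall i, expect P (w i) <= C * (2^-1) ^+ i) ->
  {ae P, forall x, cvgn (series (fun i => w i x))}.
Proof.
move=> bw w0 Ew.
have C0 : 0 <= C by have := Ew 0%N; rewrite expr0 mulr1; exact: le_trans (expect_ge0 _ _).
have mw i : measurable_fun setT (fun x => (w i x)%:E).
  by apply/measurable_EFinP; case: (bw i).
have w0' i x : (0 <= (w i x)%:E)%E by rewrite lee_fin.
have intS : P.-integrable setT (fun x => (\sum_(0 <= i <oo) (w i x)%:E)%E).
  apply/integrableP; split.
    by apply: ge0_emeasurable_sum => // i x _ _.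
  under eq_integral => x _ do rewrite gee0_abs ?nneseries_ge0//.
  rewrite integral_nneseries//.
  apply: (@le_lt_trans _ _ (2 * C)%:E); last exact: ltry.
  apply: lime_le.
    by apply: is_cvg_nneseries => i _ _; apply: integral_ge0 => x _.
  apply: nearW => m; under eq_bigr do rewrite -expectE//.
  by rewrite sumEFin lee_fin (le_trans _ (half_series_le m C0))// ler_sum.
have := integrable_ae measurableT intS; apply: filterS => x /(_ I) fx.
apply: nondecreasing_is_cvgn.
  by apply/nondecreasing_seqP => m; rewrite /series/= big_nat_recr//= lerDl.
exists (fine (\sum_(0 <= i <oo) (w i x)%:E)%E) => _ [m _ <-].
rewrite /series/= -lee_fin fineK// -sumEFin.
by apply: nneseries_lim_ge => i _ _.
Qed.

End Summable.

Section MeanErgodic.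
Context d (X : measurableType d) (R : realType) (P : probability X R).
Variable T : X -> X.
Hypothesis mT : measurable_fun setT T.
Hypothesis iT : Defs.invariant P T.
Local Notation bmf := (@bounded_measurable d X R).

(* Convex combinations of the f \o T^l. Midpoints suffice for the parallelogram
   argument, and the asymptotic averages of f and of any h in the hull agree. *)
Inductive orbit_hull (f : X -> R) : (X -> R) -> Prop :=
| hull_self : orbit_hull f f
| hull_comp h : orbit_hull f h -> orbit_hull f (h \o T)
| hull_mid h k : orbit_hull f h -> orbit_hull f k ->
    orbit_hull f (fun x => 2^-1 * (h x + k x)).

Lemma hull_bounded (f : X -> R) (M : R) h :
  measurable_fun setT f -> (forall x, `|f x| <= M) -> orbit_hull f h -> measurable_fun setT h /\ forall x, `|h x| <= M.
Proof.
move=> mf fM; elim=> {h} [//|h _ [mh hM]|h k _ [mh hM] _ [mk kM]].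
  by split=> [|x]; [exact: measurableT_comp|exact: hM].
split=> [|x].
  by apply: measurable_funM; [exact: measurable_cst|exact: measurable_funD].
rewrite normrM ger0_norm// -[M](mulKf (_ : 2 != 0 :> R))// ler_wpM2l//.
by rewrite (le_trans (ler_normD _ _))// mulr_natl mulr2n lerD.
Qed.

Lemma hull_bmf f h : bmf f -> orbit_hull f h -> bmf h.
Proof.
by move=> [mf [M fM]] /(hull_bounded mf fM)[mh hM]; split; [|exists M].
Qed.

Lemma hull_expect f h : bmf f -> orbit_hull f h -> expect P h = expect P f.
Proof.
move=> bf; elim=> {h} [//|h hh IH|h k hh IHh hk IHk].
  by rewrite expect_invariant//; exact: (hull_bmf bf).
have := hull_bmf bf hh; have := hull_bmf bf hk => bk bh.
by rewrite expectZ ?expectD// ?IHh ?IHk; [field|exact: bmfD].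
Qed.

(* AM-GM: |u| <= (e + u^2 / e) / 2 *)
Lemma expect_norm_le (u : X -> R) (e : R) : 0 < e -> bmf u ->
  expect P (fun x => u x * u x) <= e * e -> expect P (fun x => `|u x|) <= e.
Proof.
move=> e0 bu Eu.
apply: (@le_trans _ _ (expect P (fun x => (2 * e)^-1 * (e * e + u x * u x)))).
  apply: ler_expect; [exact: bmf_norm| |].
    by apply: bmfZ; apply: bmfD; [exact: bmf_cst|exact: bmfM].
  move=> x; rewrite ler_pdivlMl ?mulr_gt0//.
  have <- : `|u x| * `|u x| = u x * u x by rewrite -normrM ger0_norm// -expr2 sqr_ge0.
  rewrite -subr_ge0 [leRHS](_ : _ = (e - `|u x|) ^+ 2) ?sqr_ge0//; ring.
rewrite expectZ; last by apply: bmfD; [exact: bmf_cst|exact: bmfM].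
rewrite expectD ?expect_cst; [|exact: bmf_cst|exact: bmfM].
rewrite ler_pdivrMl ?mulr_gt0// (le_trans (lerD (lexx _) Eu))//.
by apply: eq_ler; ring.
Qed.

(** Meant for [a] the infimum of the second moments over the hull: the midpoint lies in the hull, so
    two near-minimisers are close to each other. *)
Lemma parallelogram (h k : X -> R) (a e : R) : bmf h -> bmf k ->
  expect P (fun x => h x * h x) <= a + e ->
  expect P (fun x => k x * k x) <= a + e ->
  a <= expect P (fun x => (2^-1 * (h x + k x)) * (2^-1 * (h x + k x))) ->
  expect P (fun x => (h x - k x) * (h x - k x)) <= 4 * e.
Proof.
move=> bh bk Eh Ek Em.
have bm : bmf (fun x => 2^-1 * (h x + k x)) by apply: bmfZ; exact: bmfD.
have -> : (fun x => (h x - k x) * (h x - k x)) =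
    (fun x => 2 * (h x * h x + k x * k x) -
      4 * ((2^-1 * (h x + k x)) * (2^-1 * (h x + k x)))).
  by apply/funext => x; field.
have bhh := bmfM bh bh; have bkk := bmfM bk bk; have bmm := bmfM bm bm.
rewrite expectB; [|by apply: bmfZ; exact: bmfD|exact: bmfZ].
by rewrite !expectZ ?expectD//; [lra|exact: bmfD].
Qed.

(** Near-minimisers of the second moment over the hull form a Cauchy sequence, and composing one
    with [T] gives another one as good. Their limit is therefore invariant, hence constant, and the
    constant is [expect P f] because [T] preserves [P]. *)
Lemma hull_approx f (e : R) : ergodic P T -> bmf f -> 0 < e ->
  exists2 h, orbit_hull f h & expect P (fun x => `|h x - expect P f|) <= e.
Proof.
move=> eT bf e0; have [mf [M fM]] := bf.
pose S := [set expect P (fun x => h x * h x) | h in orbit_hull f].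
have S0 : S !=set0.
  by exists (expect P (fun x => f x * f x)); exists f => //; exact: hull_self.
have lbS : has_lbound S.
  exists 0 => _ [h _ <-]; apply: expect_ge0 => x; rewrite -expr2; exact: sqr_ge0.
(* The excess is the square of 2^-i because [parallelogram] bounds squared distances: the L1
   distances are then of order 2^-i and summable. *)
pose a := inf S; pose eta (i : nat) : R := 2^-1 ^+ i * 2^-1 ^+ i.
have /choice[k kP] (i : nat) : exists h, orbit_hull f h /\
    expect P (fun x => h x * h x) <= a + eta i.
  have [|_ [h hh <-] ltE] := @inf_adherent _ S (eta i) _ (conj S0 lbS).
    by rewrite mulr_gt0 ?exprn_gt0.
  by exists h; split=> //; exact: ltW.
have hk i : orbit_hull f (k i) by case: (kP i).
have Ek i : expect P (fun x => k i x * k i x) <= a + eta i by case: (kP i).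
have bk i : bmf (k i) := hull_bmf bf (hk i).
have aS h : orbit_hull f h -> a <= expect P (fun x => h x * h x).
  by move=> hh; apply: ge_inf => //; exists h.
have close h1 h2 i : orbit_hull f h1 -> orbit_hull f h2 ->
    expect P (fun x => h1 x * h1 x) <= a + eta i ->
    expect P (fun x => h2 x * h2 x) <= a + eta i ->
    expect P (fun x => `|h1 x - h2 x|) <= 2 * 2^-1 ^+ i.
  move=> hh1 hh2 E1 E2; have b1 := hull_bmf bf hh1; have b2 := hull_bmf bf hh2.
  apply: expect_norm_le; [by rewrite mulr_gt0 ?exprn_gt0|exact: bmfB|].
  apply: (le_trans (parallelogram b1 b2 E1 E2 _)); last by apply: eq_ler; rewrite /eta; ring.
  by apply: (aS _ (hull_mid hh1 hh2)).
(* One summable series controls both the increments, for convergence, and the defect of invariance,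
   for the invariance of the limit. *)
pose w i x := `|k i.+1 x - k i x| + `|k i x - k i (T x)|.
have bkT i : bmf (k i \o T) by exact: bmf_comp.
have bw i : bmf (w i).
  by apply: bmfD; apply: bmf_norm; apply: bmfB => //; exact: bkT.
have w0 i x : 0 <= w i x by rewrite addr_ge0.
have Ew i : expect P (w i) <= 4 * 2^-1 ^+ i.
  rewrite /w expectD; [|by apply: bmf_norm; apply: bmfB|
    by apply: bmf_norm; apply: bmfB => //; exact: bkT].
  apply: (@le_trans _ _ (2 * 2^-1 ^+ i + 2 * 2^-1 ^+ i)); last by apply: eq_ler; ring.
  apply: lerD; apply: close => //.
  - apply: (le_trans (Ek _)); rewrite lerD2l /eta exprS.
    have : 0 <= 2^-1 ^+ i :> R by rewrite exprn_ge0.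
    by move: (2^-1 ^+ i) => u u0; nra.
  - exact: (hull_comp (hk i)).
  - apply: le_trans (Ek i); apply: eq_ler.
    exact: (expect_invariant mT iT (bmfM (bk i) (bk i))).
have aew := ae_cvg_series bw w0 Ew.
have kM i x : `|k i x| <= M by case: (hull_bounded mf fM (hk i)).
(* The limsup is defined, bounded and measurable even at the points where the sequence diverges. *)
pose g (x : X) : R := limn_sup (fun i => k i x).
have ubk x : bounded_fun (fun i => k i x).
  exists M; split=> [|y My i _ /=]; first exact: num_real.
  exact: le_trans (kM i x) (ltW My).
have cvgk : {ae P, forall x, (fun i => k i x) @ \oo --> g x}.
  apply: filterS aew => x cw.
  suff ck : cvgn (fun i => k i x) by rewrite /g (cvg_limn_supE ck).
  have ctel : cvgn (series (telescope (fun i => k i x))).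
    apply: normed_cvg; apply: series_le_cvg cw => // i; first exact: normr_ge0.
    by rewrite /w /telescope/= lerDl.
  have -> : (fun i => k i x) = (fun i => k 0%N x + series (telescope (fun i => k i x)) i).
    by apply/funext => i; rewrite -eq_sum_telescope.
  by apply: is_cvgD ctel; exact: is_cvg_cst.
have mg : measurable_fun setT g.
  apply: measurable_fun_limn_sup => [x _|x _|i]; last by case: (bk i).
  - exact: bounded_fun_has_ubound.
  - exact: bounded_fun_has_lbound.
have gM x : `|g x| <= M.
  have subM n : sups (fun i => k i x) n <= M.
    apply: ge_sup => [|_ [i _ <-]]; first by exists (k n x); exists n => /=.
    by have := kM i x; rewrite ler_norml => /andP[].
  rewrite /g limn_supE// ler_norml; apply/andP; split.
    apply: lb_le_inf => [|_ [n _ <-]].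
      by exists (sups (fun i => k i x) 0%N); exists 0%N.
    apply: (@le_trans _ _ (k n x)); first by have := kM n x; rewrite ler_norml => /andP[].
    apply: ub_le_sup; last by exists n => /=.
    exact/has_ubound_sdrop/bounded_fun_has_ubound.
  apply: le_trans (subM 0%N); apply: ge_inf; last by exists 0%N.
  exact: bounded_fun_has_lbound_sups.
have bg : bmf g by split=> //; exists M.
have gT : {ae P, forall x, g (T x) = g x}.
  apply: filterS2 aew cvgk => x cw kg.
  have kT0 : (fun i => k i x - k i (T x)) @ \oo --> (0 : R).
    apply/norm_cvg0P; apply: (squeeze_cvgr (f := fun=> 0) (h := fun i => w i x)).
    - by apply: nearW => i; rewrite /w /= !normr_ge0 lerDr normr_ge0.
    - exact: cvg_cst.
    - exact: cvg_series_cvg_0.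
  have kTg : (fun i => k i (T x)) @ \oo --> g x.
    have -> : (fun i => k i (T x)) = (fun i => k i x - (k i x - k i (T x))).
      by apply/funext => i; rewrite opprB addrC subrK.
    by rewrite -[g x]subr0; exact: cvgB kg kT0.
  by rewrite /g (cvg_limn_inf_sup kTg).2.
have [c gc] := ergodic_ae_cst mT iT eT bg gT.
have dist0 : (fun i => expect P (fun x => `|k i x - c|)) @ \oo --> (0 : R).
  have bd i : bmf (fun x => `|k i x - c|) by apply/bmf_norm/bmfB => //; exact: bmf_cst.
  have [|||||_ _] := @dominated_convergence _ X R P setT measurableT
    (fun i x => (`|k i x - c|)%:E) (cst 0%E) (cst (M + `|c|)%:E).
  - by move=> i; apply/measurable_EFinP; case: (bd i).
  - exact: measurable_cst.
  - apply: filterS2 cvgk gc => x kg gxc _; apply: cvg_EFin; first exact: nearW.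
    have := kg; rewrite gxc => kc; rewrite /comp/=.
    have := cvg_norm (cvgB kc (cvg_cst c)); rewrite subrr normr0; exact.
  - by apply: (@bmf_integrable _ _ _ P (fun=> M + `|c|)); exact: bmf_cst.
  - apply: aeW => x i _; rewrite /= lee_fin normr_id (le_trans (ler_normB _ _))//.
    by rewrite lerD2r.
  rewrite integral0 => h; exact: fine_cvg h.
have Ec : expect P f = c.
  apply/eqP; rewrite -subr_eq0 -normr_le0; apply/ler_addgt0Pr => r r0; rewrite add0r.
  have /cvgr0Pnorm_le/(_ _ r0)[N _ /(_ N (leqnn N))] := dist0.
  apply: le_trans; rewrite [leRHS]ger0_norm; last exact: expect_ge0.
  rewrite -(hull_expect bf (hk N)) -{1}(expect_cst P c) -expectB//; last exact: bmf_cst.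
  by apply: ler_norm_expect; apply: bmfB => //; exact: bmf_cst.
have /cvgr0Pnorm_le/(_ _ e0)[N _ /(_ N (leqnn N))] := dist0.
by rewrite ger0_norm; [exists (k N) => //; rewrite Ec|exact: expect_ge0].
Qed.

End MeanErgodic.

Section Correlation.
Context d (X : measurableType d) (R : realType) (P : probability X R).
Variable T : X -> X.
Hypothesis mT : measurable_fun setT T.
Hypothesis iT : Defs.invariant P T.
Local Notation bmf := (@bounded_measurable d X R).
Implicit Types (f g h : X -> R).

Definition corr f g (j : nat) : R := expect P (fun x => f (iter j T x) * g x).

Lemma bmf_iter f j : bmf f -> bmf (fun x => f (iter j T x)).
Proof. by move=> bf; apply: (bmf_comp (measurable_iter j mT) bf). Qed.

Lemma expect_iter f j : bmf f -> expect P (fun x => f (iter j T x)) = expect P f.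
Proof.
move=> bf; elim: j => [//|j <-].
rewrite -(expect_invariant mT iT (bmf_iter j bf)).
by congr expect; apply/funext => x; rewrite /= -iterSr.
Qed.

Lemma corr_le f g (N : R) j : bmf f -> bmf g -> (forall x, `|g x| <= N) ->
  `|corr f g j| <= N * expect P (fun x => `|f x|).
Proof.
move=> bf bg gN; have bfj := bmf_iter j bf.
rewrite (le_trans (ler_norm_expect P (bmfM bfj bg)))//.
rewrite -(expect_iter j (bmf_norm bf)) -expectZ; last exact: bmf_norm.
apply: ler_expect; [exact/bmf_norm/bmfM|exact/bmfZ/bmf_norm|move=> x].
by rewrite normrM mulrC ler_wpM2r.
Qed.

Lemma corr_bounded f g : bmf f -> bmf g -> exists C, forall j, `|corr f g j| <= C.
Proof.
move=> bf bg; have [_ [N gN]] := bg.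
by exists (N * expect P (fun x => `|f x|)) => j; exact: corr_le.
Qed.

Lemma corrB f h g j : bmf f -> bmf h -> bmf g ->
  corr (fun x => f x - h x) g j = corr f g j - corr h g j.
Proof.
move=> bf bh bg; rewrite /corr -expectB; [|exact/bmfM/bg/bmf_iter..].
by congr expect; apply/funext => x; rewrite mulrBl.
Qed.

Lemma corr_cst (c : R) g j : bmf g -> corr (fun=> c) g j = c * expect P g.
Proof. by move=> bg; rewrite /corr expectZ. Qed.

(** Composing [h] with [T] shifts the index of the correlation by one, which Følner averages do not
    see in the limit; midpoints are handled by linearity. *)
Lemma hull_average f g h F : folner R F -> bmf f -> bmf g ->
  orbit_hull T f h ->
  (fun m => average (F m) (corr f g) - average (F m) (corr h g)) @ \oo --> (0 : R).
Proof.
move=> [F0 FF] bf bg; elim=> {h} [|h hh IH|h k hh IHh hk IHk].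
- under eq_fun do rewrite subrr.
  exact: cvg_cst.
- have bh := hull_bmf mT bf hh; have [C hC] := corr_bounded bh bg.
  have -> : (fun m => average (F m) (corr f g) - average (F m) (corr (h \o T) g)) =
    (fun m => (average (F m) (corr f g) - average (F m) (corr h g)) -
     (average (F m) (fun j => corr h g j.+1) - average (F m) (corr h g))).
    have -> : (fun j => corr h g j.+1) = corr (h \o T) g by [].
    by apply/funext => m; rewrite opprB addrA subrK.
  rewrite -[0]subr0; apply: cvgB => //; apply/norm_cvg0P.
  have C_cvg : (fun m => C * (#|` fsymdiff (fshift (F m) 1) (F m) |%:R
      / #|` F m|%:R)) @ \oo --> (0 : R).
    by rewrite -[0](mulr0 C); apply: cvgM; [exact: cvg_cst|exact: FF].
  apply: (squeeze_cvgr (f := fun=> 0) _ (cvg_cst 0) C_cvg).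
  by apply: nearW => m; rewrite normr_ge0 average_shift.
- have bh := hull_bmf mT bf hh; have bk := hull_bmf mT bf hk.
  have -> : (fun m => average (F m) (corr f g) -
       average (F m) (corr (fun x => 2^-1 * (h x + k x)) g)) =
    (fun m => 2^-1 * ((average (F m) (corr f g) - average (F m) (corr h g)) +
     (average (F m) (corr f g) - average (F m) (corr k g)))).
    apply/funext => m.
    have -> : corr (fun x => 2^-1 * (h x + k x)) g =
        fun j => 2^-1 * (corr h g j + corr k g j).
      apply/funext => j.
      have bhg := bmfM (bmf_iter j bh) bg; have bkg := bmfM (bmf_iter j bk) bg.
      rewrite /corr -expectD -?expectZ; [|exact: bmfD|by []..].
      by congr expect; apply/funext => x; rewrite -mulrDl mulrA.
    by rewrite averageZ averageD; field.
  rewrite -[0](mulr0 2^-1) -[in X in _ --> X](addr0 0).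
  by apply: cvgM; [exact: cvg_cst|exact: cvgD].
Qed.

(** [f] may be replaced by a hull element that is L1-close to its mean; each single correlation of
    that element with [g] is then close to the product of the expectations, uniformly in [j]. *)
Lemma mean_ergodic f g F : folner R F -> ergodic P T -> bmf f -> bmf g ->
  (fun m => average (F m) (corr f g)) @ \oo --> expect P f * expect P g.
Proof.
move=> FF eT bf bg; have [F0 _] := FF; have [_ [N gN]] := bg.
have N0 : 0 <= N by exact: le_trans (gN point).
apply/cvgrPdist_le => e e0.
have e20 : 0 < e / 2 by rewrite divr_gt0.
(* [N + 1] because the bound [N] of [g] may be 0. *)
have d0 : 0 < e / 2 / (N + 1) by rewrite divr_gt0// ltr_wpDl.
have [h hh Eh] := hull_approx mT iT eT bf d0.
have bh := hull_bmf mT bf hh.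
have bhc : bmf (fun x => h x - expect P f) by apply: bmfB => //; exact: bmf_cst.
have near_h m : `|average (F m) (corr h g) - expect P f * expect P g| <= e / 2.
  rewrite -(average_cst (expect P f * expect P g) (F0 m)) -averageB.
  apply: ler_norm_average => // j.
  rewrite -(corr_cst _ j bg) -corrB//; last exact: bmf_cst.
  apply: (le_trans (corr_le j bhc bg gN)).
  apply: (@le_trans _ _ (N * (e / 2 / (N + 1)))); first exact: ler_wpM2l.
  rewrite mulrA ler_pdivrMr ?ltr_wpDl// [leRHS]mulrC ler_wpM2r ?ltW//.
  by rewrite ltrDl.
have /cvgr0Pnorm_le/(_ _ e20) := hull_average FF bf bg hh.
apply: filterS => m close; rewrite distrC.
rewrite (_ : _ - _ = (average (F m) (corr f g) - average (F m) (corr h g)) +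
  (average (F m) (corr h g) - expect P f * expect P g)); last by ring.
by rewrite (splitr e) (le_trans (ler_normD _ _))// lerD.
Qed.

End Correlation.

(** * Weak mixing through the product system *)

Section WeakMixing.
Context d (X : measurableType d) (R : realType) (P : probability X R).
Variable T : X -> X.
Hypothesis mT : measurable_fun setT T.
Hypothesis iT : Defs.invariant P T.
Local Notation bmf := (@bounded_measurable d X R).
Local Notation PP := (P \x P)%E.
Let TT := fun p : X * X => (T p.1, T p.2).

Lemma bmf_prod (a b : X -> R) : bmf a -> bmf b ->
  bounded_measurable (fun p : X * X => a p.1 * b p.2).
Proof.
move=> [ma [M aM]] [mb [N bN]].
apply: (@bmfM _ _ _ (a \o fst) (b \o snd)).
  by split; [exact: measurableT_comp|exists M => x /=].
by split; [exact: measurableT_comp|exists N => x /=].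
Qed.

Lemma expect_prod (a b : X -> R) : bmf a -> bmf b ->
  expect PP (fun p => a p.1 * b p.2) = expect P a * expect P b.
Proof.
move=> ba bb; apply: EFin_inj; rewrite expectE; last exact: bmf_prod.
rewrite -(@integral12_prod_meas1 _ _ _ _ _ P P (fun p => (a p.1 * b p.2)%:E)); last first.
  exact: (bmf_integrable PP (bmf_prod ba bb)).
rewrite /fubini_F/=.
under eq_integral => x _ do (rewrite -(expectE P (bmfZ (a x) bb)) expectZ//; rewrite mulrC).
by rewrite -(expectE P (bmfZ (expect P b) ba)) expectZ// mulrC.
Qed.

Lemma measurable_TT : measurable_fun setT TT.
Proof. by apply: measurable_fun_pair; exact: measurableT_comp. Qed.

Lemma invariant_TT : Defs.invariant PP TT.
Proof.
move=> A mA.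
have mTT := measurable_TT.
pose m' := measure_function_pushforward__canonical__measure_function_Measure PP mTT.
apply/esym; apply: (product_measure_unique (m' := m')) => // B C mB mC.
rewrite /= /pushforward (_ : TT @^-1` _ = (T @^-1` B) `*` (T @^-1` C))//.
have mpre D : measurable D -> measurable (T @^-1` D).
  by move=> mD; rewrite -[_ @^-1` _]setTI; exact: mT.
by rewrite product_measure1E; [congr (_ * _)%E; exact: iT|exact: mpre..].
Qed.

(** The square of a correlation is a correlation of the product system, and so is the correlation
    itself, the second factor being the constant 1. The mean ergodic theorem there gives the limit
    c^2 - 2 c c + c^2 of the expanded square. *)
Lemma weak_mixing_square f g (F : nat -> {fset nat}) :
  weakly_mixing P T -> folner R F -> bmf f -> bmf g ->
  (fun m => average (F m) (fun j =>
     (corr P T f g j - expect P f * expect P g) ^+ 2)) @ \oo --> (0 : R).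
Proof.
move=> wT FF bf bg; have [F0 _] := FF.
have mTT := measurable_TT; have iTT := invariant_TT.
pose c := expect P f * expect P g; have b1 := bmf_cst X (1 : R).
have iterTT j p : iter j TT p = (iter j T p.1, iter j T p.2).
  by elim: j => [|j /= ->//]; case: p.
have corr_prod a b a' b' : bmf a -> bmf b -> bmf a' -> bmf b' ->
    corr PP TT (fun p => a p.1 * b p.2) (fun p => a' p.1 * b' p.2) =
    fun j => corr P T a a' j * corr P T b b' j.
  move=> ba bb ba' bb'; apply/funext => j.
  rewrite /corr -expect_prod; [|exact/bmfM/ba'/bmf_iter|exact/bmfM/bb'/bmf_iter].
  by congr expect; apply/funext => p; rewrite iterTT/= mulrACA.
have me a b a' b' : bmf a -> bmf b -> bmf a' -> bmf b' ->
    (fun m => average (F m) (fun j => corr P T a a' j * corr P T b b' j)) @ \oo -->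
    (expect P a * expect P b) * (expect P a' * expect P b').
  move=> ba bb ba' bb'; rewrite -corr_prod// -!expect_prod//.
  exact: (mean_ergodic mTT iTT FF wT (bmf_prod ba bb) (bmf_prod ba' bb')).
have m1 := me _ _ _ _ bf b1 bg b1; have m2 := me _ _ _ _ bf bf bg bg.
have -> : (fun m => average (F m) (fun j => (corr P T f g j - c) ^+ 2)) =
  (fun m => average (F m) (fun j => corr P T f g j * corr P T f g j) -
    2 * c * average (F m) (fun j => corr P T f g j * corr P T (fun=> 1) (fun=> 1) j)
    + c * c).
  apply/funext => m; rewrite -(average_cst (c * c) (F0 m)) -averageZ -averageB -averageD.
  congr average; apply/funext => j; rewrite corr_cst// expect_cst; ring.
have -> : 0 = (expect P f * expect P f) * (expect P g * expect P g) -
    2 * c * ((expect P f * expect P (fun=> 1)) * (expect P g * expect P (fun=> 1))) + c * c.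
  by rewrite /c expect_cst; ring.
apply: cvgD; last exact: cvg_cst.
by apply: cvgB => //; apply: cvgM => //; exact: cvg_cst.
Qed.

End WeakMixing.

(** * Limits along sets of positive upper density *)

Section Density.
Context {R : realType}.
Implicit Types (F : nat -> {fset nat}) (E : set nat) (s t : nat -> R).

Lemma density_average (F : {fset nat}) E :
  #|` [fset x in F | `[< E x >]]%fset |%:R / #|` F |%:R =
  average F (fun j => (`[< E j >])%:R) :> R.
Proof.
rewrite /average -sum1_size natr_sum; congr (_ / _).
rewrite [RHS](eq_bigr (fun j => if `[< E j >] then 1 else 0)); last by move=> j _; case: ifP.
by rewrite -big_mkcond [RHS]big_fset_condE.
Qed.

Lemma limn_sup_gt (u : nat -> R) (a : R) : bounded_fun u -> a < limn_sup u ->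
  forall N, exists2 m, (N <= m)%N & a < u m.
Proof.
move=> bu au N.
have : a < sups u N.
  apply: (lt_le_trans au); rewrite limn_supE//; apply: ge_inf; last by exists N.
  exact: bounded_fun_has_lbound_sups.
have hs : has_sup [set u n | n in [set n | (N <= n)%N]].
  split; first by exists (u N); exists N => /=.
  exact/has_ubound_sdrop/bounded_fun_has_ubound.
by move=> /(sup_gt hs.1)[_ [m /= Nm <-]] am; exists m.
Qed.

Lemma upper_density_gt F E (a : R) : (forall m, F m != fset0) ->
  a < upper_density R F E ->
  forall N, exists2 m, (N <= m)%N & a < average (F m) (fun j => (`[< E j >])%:R).
Proof.
move=> F0 aE N.
have [|m Nm] := limn_sup_gt _ aE N.
  exists 1; split; first exact: num_real.
  move=> y y1 m _ /=; rewrite density_average; apply: le_trans (ltW y1).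
  by apply: ler_norm_average => // j; case: `[< _ >]; rewrite ?normr1 ?normr0.
by rewrite density_average; exists m.
Qed.

(** Boundedness is included because it is the only control on [s] at indices outside the set of
    upper density 1. *)
Definition cesaro_limit F s (c : R) :=
  (exists M, forall j, `|s j| <= M) /\ (fun m => average (F m) s) @ \oo --> c.

Lemma cesaro_limitD F s t a b : cesaro_limit F s a -> cesaro_limit F t b ->
  cesaro_limit F (fun j => s j + t j) (a + b).
Proof.
move=> [[M sM] sa] [[N tN] tb]; split.
  by exists (M + N) => j; rewrite (le_trans (ler_normD _ _))// lerD.
by under eq_fun do rewrite averageD; exact: cvgD.
Qed.

Lemma cesaro_limitB F s t a b : cesaro_limit F s a -> cesaro_limit F t b ->
  cesaro_limit F (fun j => s j - t j) (a - b).
Proof.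
move=> [[M sM] sa] [[N tN] tb]; split.
  by exists (M + N) => j; rewrite (le_trans (ler_normB _ _))// lerD.
by under eq_fun do rewrite averageB; exact: cvgB.
Qed.

(** For arbitrarily large m, [E] fills all but a small share of [F m], and the remaining indices
    move the average by at most [C] times that share. *)
Lemma cesaro_limit_cst F E s (c k : R) : (forall m, F m != fset0) ->
  upper_density R F E = 1 -> cesaro_limit F s c ->
  (forall j, E j -> s j = k) -> c = k.
Proof.
move=> F0 dE [[M sM] sc] sk.
have M0 : 0 <= M by exact: le_trans (sM 0%N).
pose C := M + `|k| + 1.
have C0 : 0 < C by rewrite /C; have := normr_ge0 k; lra.
apply/eqP; rewrite -subr_eq0 -normr_le0; apply/ler_addgt0Pr => e e0; rewrite add0r.
have e20 : 0 < e / 2 by rewrite divr_gt0.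
have /cvgrPdist_le/(_ _ e20)[N _ cN] := sc.
have [|m Nm dm] := @upper_density_gt F E (1 - e / 2 / C) F0 _ N.
  by rewrite dE gtrBl divr_gt0.
rewrite (_ : c - k = (c - average (F m) s) + (average (F m) s - k)); last by ring.
rewrite (splitr e) (le_trans (ler_normD _ _))// lerD//; first exact: cN.
rewrite -{1}(average_cst k (F0 m)) -averageB.
apply: (@le_trans _ _ (average (F m) (fun j => C * (1 - (`[< E j >])%:R)))).
  have pw j : `|s j - k| <= C * (1 - (`[< E j >])%:R).
    have [/sk->|_] := asboolP (E j); first by rewrite !subrr normr0 mulr0.
    rewrite subr0 mulr1 (le_trans (ler_normB _ _))// /C.
    by have := sM j; lra.
  rewrite ler_norml; apply/andP; split; last first.
    by apply: ler_average => j; have := pw j; rewrite ler_norml => /andP[].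
  rewrite lerNl -mulN1r -averageZ; apply: ler_average => j; rewrite mulN1r lerNl.
  by have := pw j; rewrite ler_norml => /andP[].
rewrite averageZ averageB average_cst// mulrC -ler_pdivlMr//.
by rewrite lerBlDl -lerBlDr ltW.
Qed.

(** Strong Cesàro convergence in mean square. Squares make the quantity a polynomial in the
    correlations, so that it can be computed in the product system. *)
Definition strong_cesaro_limit F s (c : R) :=
  (fun m => average (F m) (fun j => (s j - c) ^+ 2)) @ \oo --> (0 : R).

Lemma average_ge0 (F : {fset nat}) s : (forall j, 0 <= s j) -> 0 <= average F s.
Proof. by move=> s0; rewrite /average divr_ge0// sumr_ge0. Qed.

Lemma strong_cesaro_limit_le F s t u (a b c : R) :
  strong_cesaro_limit F s a -> strong_cesaro_limit F t b ->
  (forall j, (u j - c) ^+ 2 <= 2 * ((s j - a) ^+ 2 + (t j - b) ^+ 2)) ->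
  strong_cesaro_limit F u c.
Proof.
move=> sa tb uc.
have lim0 : (fun m => 2 * (average (F m) (fun j => (s j - a) ^+ 2) +
    average (F m) (fun j => (t j - b) ^+ 2))) @ \oo --> (0 : R).
  rewrite -[0](mulr0 2) -[in X in _ --> X](addr0 0).
  by apply: cvgM; [exact: cvg_cst|exact: cvgD].
apply: (squeeze_cvgr (f := fun=> 0) _ (cvg_cst 0) lim0).
apply: nearW => m; rewrite -averageD -averageZ ler_average// andbT.
by apply: average_ge0 => j; exact: sqr_ge0.
Qed.

Lemma strong_cesaro_limitD F s t a b :
  strong_cesaro_limit F s a -> strong_cesaro_limit F t b ->
  strong_cesaro_limit F (fun j => s j + t j) (a + b).
Proof.
move=> sa tb; apply: (strong_cesaro_limit_le sa tb) => j.
rewrite -subr_ge0 [leRHS](_ : _ = ((s j - a) - (t j - b)) ^+ 2) ?sqr_ge0//; ring.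
Qed.

Lemma strong_cesaro_limitB F s t a b :
  strong_cesaro_limit F s a -> strong_cesaro_limit F t b ->
  strong_cesaro_limit F (fun j => s j - t j) (a - b).
Proof.
move=> sa tb; apply: (strong_cesaro_limit_le sa tb) => j.
rewrite -subr_ge0 [leRHS](_ : _ = ((s j - a) + (t j - b)) ^+ 2) ?sqr_ge0//; ring.
Qed.

(** If [c] and [k] differed, the indices in [E] alone would keep the mean-square deviation above a
    positive constant for arbitrarily large m. Half the upper density serves as a lower bound of
    their share. *)
Lemma strong_cesaro_limit_cst F E s (c k : R) : (forall m, F m != fset0) ->
  upper_density R F E > 0 -> strong_cesaro_limit F s c ->
  (forall j, E j -> s j = k) -> c = k.
Proof.
move=> F0 dE sc sk; pose D := upper_density R F E / 2.
have D0 : 0 < D by rewrite divr_gt0.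
apply/eqP/negPn/negP => ck.
have e0 : 0 < D * (k - c) ^+ 2.
  by rewrite mulr_gt0// exprn_even_gt0//= subr_eq0 eq_sym.
have /cvgr0Pnorm_lt/(_ _ e0)[N _ cN] := sc.
have [|m Nm dm] := @upper_density_gt F E D F0 _ N.
  by rewrite /D ltr_pdivrMr// ltr_pMr// ltr1n.
have := cN m Nm; rewrite ger0_norm; last by apply: average_ge0 => j; exact: sqr_ge0.
apply/negP; rewrite -leNgt.
apply: (@le_trans _ _ (average (F m) (fun j => (k - c) ^+ 2 * (`[< E j >])%:R))).
  by rewrite averageZ mulrC ler_wpM2l ?sqr_ge0// ltW.
apply: ler_average => j; have [/sk->|_] := asboolP (E j); first by rewrite mulr1.
by rewrite mulr0 sqr_ge0.
Qed.

(* If the s_i take the value 1 in turn, the sum over i of the normalized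
   deviations ((s_i - c_i) / (1 - c_i))^2 is always at least 1. *)
Lemma strong_cesaro_limit_finite (I : finType) F (s : I -> nat -> R) (c : I -> R) :
  (forall m, F m != fset0) -> (forall i, strong_cesaro_limit F (s i) (c i)) ->
  (forall j, exists i, s i j = 1) -> exists i, c i = 1.
Proof.
move=> F0 sc s1; apply: contrapT => /forallNP c1.
have c10 i : (1 - c i) ^- 2 != 0.
  by rewrite invr_eq0 expf_eq0/= subr_eq0; apply/negP => /eqP/esym/c1.
have lim0 : (fun m => \sum_i (1 - c i) ^- 2 *
    average (F m) (fun j => (s i j - c i) ^+ 2)) @ \oo --> (0 : R).
  elim: (index_enum I) => [|i r IH].
    by under eq_fun do rewrite big_nil; exact: cvg_cst.
  have sci : (fun m => (1 - c i) ^- 2 * average (F m) (fun j => (s i j - c i) ^+ 2))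
      @ \oo --> (0 : R).
    by rewrite -[0](mulr0 ((1 - c i) ^- 2)); apply: cvgM; [exact: cvg_cst|exact: sc].
  suff : (fun m => \sum_(l <- i :: r) (1 - c l) ^- 2 *
      average (F m) (fun j => (s l j - c l) ^+ 2)) @ \oo --> (0 + 0 : R) by rewrite addr0.
  rewrite [X in X @ _](_ : _ = (fun m => (1 - c i) ^- 2 *
    average (F m) (fun j => (s i j - c i) ^+ 2) + \sum_(l <- r) (1 - c l) ^- 2 *
      average (F m) (fun j => (s l j - c l) ^+ 2))).
    exact: cvgD.
  by apply/funext => m; rewrite big_cons.
have /cvgr0Pnorm_lt/(_ _ ltr01)[N _ /(_ N (leqnn N))] := lim0.
apply/negP; rewrite -leNgt (le_trans _ (ler_norm _))//.
rewrite -[leLHS](average_cst 1 (F0 N)).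
have -> : \sum_i (1 - c i) ^- 2 * average (F N) (fun j => (s i j - c i) ^+ 2) =
    average (F N) (fun j => \sum_i (1 - c i) ^- 2 * (s i j - c i) ^+ 2).
  under eq_bigr do rewrite -averageZ.
  by rewrite /average -mulr_suml exchange_big.
apply: ler_average => j; have [i sij] := s1 j.
rewrite (bigD1 i)//= sij mulVf; last by rewrite -invr_eq0.
rewrite lerDl sumr_ge0// => l _.
by rewrite mulr_ge0 ?invr_ge0 ?sqr_ge0.
Qed.

End Density.

Lemma infinite_nat_unbounded (E : set nat) : infinite_set E ->
  forall m, exists2 e, (m <= e)%N & E e.
Proof.
move=> Einf m; apply: contrapT => nE; apply: Einf.
apply: (sub_finite_set _ (finite_II m)) => j Ej /=.
by rewrite ltnNge; apply/negP => mj; apply: nE; exists j.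
Qed.

(** * Fourier coefficients of measures on the torus *)

Section Cosine.
Context {R : realType}.
Implicit Types (t : R) (z : int).

Definition costurn t : R := cos (pi *+ 2 * t).
Definition sinturn t : R := sin (pi *+ 2 * t).

Lemma costurnD s t : costurn (s + t) = costurn s * costurn t - sinturn s * sinturn t.
Proof. by rewrite /costurn mulrDr cosD. Qed.

Lemma sinturnD s t : sinturn (s + t) = sinturn s * costurn t + costurn s * sinturn t.
Proof. by rewrite /sinturn mulrDr sinD. Qed.

Lemma costurnN t : costurn (- t) = costurn t.
Proof. by rewrite /costurn mulrN cosN. Qed.

Lemma sinturnN t : sinturn (- t) = - sinturn t.
Proof. by rewrite /sinturn mulrN sinN. Qed.

Lemma costurn_intr z : costurn z%:~R = 1.
Proof.
have nat_case (m : nat) : costurn m%:R = 1.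
  rewrite /costurn -[_ * _]add0r mulr_natr (periodicn (@cosD2pi R)).
  exact: cos0.
by case: z => m; rewrite ?NegzE ?mulrNz ?costurnN -pmulrn nat_case.
Qed.

Lemma sinturn_intr z : sinturn z%:~R = 0.
Proof.
have := cos2Dsin2 (pi *+ 2 * z%:~R : R).
rewrite -/(costurn _) -/(sinturn _) costurn_intr expr1n.
by move/eqP; rewrite addrC -subr_eq0 addrK sqrf_eq0 => /eqP.
Qed.

Lemma costurnDz t z : costurn (t + z%:~R) = costurn t.
Proof. by rewrite costurnD costurn_intr sinturn_intr mulr1 mulr0 subr0. Qed.

Lemma sinturnDz t z : sinturn (t + z%:~R) = sinturn t.
Proof. by rewrite sinturnD costurn_intr sinturn_intr mulr1 mulr0 addr0. Qed.

(** Rounding to the nearest integer brings the angle into [0, pi], where the cosine decreases. *)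
Lemma costurn_gt (e t : R) : 0 < e -> e < 2^-1 -> costurn e < costurn t ->
  exists z, `|t - z%:~R| < e.
Proof.
move=> e0 e1 et; pose z := Num.floor (t + 2^-1); exists z.
have zle : z%:~R <= t + 2^-1 by exact: Num.Theory.floor_le_tmp.
have zlt : t + 2^-1 < (z + 1)%:~R by exact: Num.Theory.floorD1_gt.
have pi0 : 0 < pi *+ 2 :> R by rewrite pmulrn_lgt0// pi_gt0.
rewrite intrD in zlt.
have s_le : `|t - z%:~R| <= 2^-1 by rewrite ler_norml; apply/andP; split; lra.
have : costurn e < costurn `|t - z%:~R|.
  apply: (lt_le_trans et); rewrite -(costurnDz t (- z)) intrN.
  by case: (ler0P (t - z%:~R)) => _; rewrite ?costurnN.
have range (s : R) : 0 <= s -> s <= 2^-1 -> pi *+ 2 * s \in `[0, pi].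
  move=> s0 s1; rewrite in_itv/=; apply/andP; split; first exact: mulr_ge0 (ltW pi0) s0.
  have := pi_gt0 R; rewrite mulr2n => ppi; nra.
rewrite /costurn ltr_cos; [by rewrite ltr_pM2l|exact: range|].
exact: range (ltW e0) (ltW e1).
Qed.

Lemma costurn_eq1 t : costurn t = 1 -> exists z, t = z%:~R.
Proof.
move=> t1; pose z := Num.floor t; exists z.
have zle : z%:~R <= t by exact: Num.Theory.floor_le_tmp.
have zlt : t < (z + 1)%:~R by exact: Num.Theory.floorD1_gt.
rewrite intrD in zlt.
apply/eqP; rewrite eq_le zle andbT -subr_le0 leNgt; apply/negP => s0.
(* For the fractional part s, cos(2 pi s) = 1 forces sin(pi s) = 0 by the double angle formula,
   whereas the sine is positive on the open interval (0, pi). *)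
have := cos_mulr2n (pi * (t - z%:~R)).
rewrite -mulrnAl -/(costurn _) -intrN costurnDz t1 => h.
have c1 : cos (pi * (t + (- z)%:~R)) ^+ 2 = 1 by rewrite mulr2n in h; lra.
have : sin (pi * (t + (- z)%:~R)) = 0.
  by apply/eqP; rewrite -sqrf_eq0 sin2cos2 c1 subrr.
apply/eqP; rewrite gt_eqF// sin_gt0_pi// intrN mulr_gt0 ?pi_gt0//=.
by rewrite gtr_pMr ?pi_gt0//; lra.
Qed.

Lemma continuous_costurn : continuous costurn.
Proof.
move=> t; apply: (@continuous_comp _ _ _ (fun t => pi *+ 2 * t) cos); last exact: continuous_cos.
by apply: cvgM; [exact: cvg_cst|exact: cvg_id].
Qed.

Lemma continuous_sinturn : continuous sinturn.
Proof.
move=> t; apply: (@continuous_comp _ _ _ (fun t => pi *+ 2 * t) sin); last exact: continuous_sin.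
by apply: cvgM; [exact: cvg_cst|exact: cvg_id].
Qed.

End Cosine.

Section Torus.
Context {R : realType} {n : nat}.
Local Notation intmx := (map_mx (fun z : int => z%:~R : R)).
Implicit Types (x t : 'rV[R]_n) (u v : 'cV[int]_n) (C : 'M[int]_n).

Definition dot x v : R := (x *m intmx v) 0 0.

Lemma dotDl x t v : dot (x + t) v = dot x v + dot t v.
Proof. by rewrite /dot mulmxDl mxE. Qed.

Lemma dotDr x u v : dot x (u + v) = dot x u + dot x v.
Proof. by rewrite /dot map_mxD mulmxDr mxE. Qed.

Lemma dotNr x v : dot x (- v) = - dot x v.
Proof. by rewrite /dot map_mxN mulmxN mxE. Qed.

Lemma dot0r x : dot x 0 = 0.
Proof. by rewrite /dot map_mx0 mulmx0 mxE. Qed.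

Lemma dot_intvec (k : 'rV[int]_n) v : exists z : int, dot (@intvec R n k) v = z%:~R.
Proof. by exists ((k *m v) 0 0); rewrite /dot /intvec -map_mxM mxE. Qed.

Lemma dot_Tmap C x v : dot (@Tmap R n C x) v = dot x (C *m v).
Proof. by rewrite /dot /Tmap map_mxM mulmxA. Qed.

Lemma dot_delta x i : dot x (delta_mx i 0) = x 0 i.
Proof.
rewrite /dot mxE (bigD1 i)//= !mxE !eqxx mulr1 big1 ?addr0// => j ji.
by rewrite !mxE (negbTE ji) mulr0.
Qed.

Lemma continuous_mx (T : topologicalType) (p q : nat) (f : T -> 'M[R]_(p, q)) :
  (forall i j, continuous (fun y : T => f y i j)) -> continuous f.
Proof.
move=> cf x A [B nB BA]; apply: filterS (_ : nbhs x (fun y => forall i j, B i j (f y i j))).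
  by move=> y By; exact: BA.
have all_near i : nbhs x (fun y => forall j, B i j (f y i j)).
  by apply: filter_forall => j; apply: cf; exact: nB.
exact: filter_forall all_near.
Qed.

Lemma continuous_mulmx (p : nat) (M : 'M[R]_(n, p)) : continuous (fun x => x *m M).
Proof.
apply: continuous_mx => i j.
have -> : (fun y : 'rV_n => (y *m M) i j) = (fun y => \sum_k y i k * M k j).
  by apply/funext => y; rewrite mxE.
elim: (index_enum _) => [|k r IH].
  rewrite (_ : (fun=> _) = fun=> 0); first exact: cst_continuous.
  by apply/funext => y; rewrite big_nil.
rewrite (_ : (fun y : 'rV_n => _) =
  (fun y => y i k * M k j + \sum_(l <- r) y i l * M l j)); last first.
  by apply/funext => y; rewrite big_cons.
move=> y; apply: continuousD (IH y).
exact: (continuousM (@coord_continuous _ _ _ i k y) (@cst_continuous _ _ (M k j) y)).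
Qed.

Lemma continuous_dot v : continuous (dot^~ v).
Proof.
move=> x; apply: (@continuous_comp _ _ _ (fun x => x *m intmx v) (fun M : 'M[R]_(1, 1) => M 0 0)).
  exact: continuous_mulmx.
exact: coord_continuous.
Qed.

Lemma measurable_periodic (f : 'rV[R]_n -> R) : continuous f ->
  (forall x k, f (x + @intvec R n k) = f x) ->
  measurable_fun setT (f : torus R n -> R).
Proof.
move=> cf pf; apply: (measurability _ (RGenOInfty.measurableE R)) => // _ [_ [a ->] <-].
rewrite setTI; apply: sub_sigma_algebra; split.
  by apply: open_comp => [x _|]; [exact: cf|exact: rray_open].
by move=> x k /=; rewrite !in_itv/= pf.
Qed.

Lemma measurable_torus_map (f : 'rV[R]_n -> 'rV[R]_n) : continuous f ->
  (forall x k, exists k', f (x + @intvec R n k) = f x + @intvec R n k') ->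
  measurable_fun setT (f : torus R n -> torus R n).
Proof.
move=> cf pf.
have mE : (@measurable _ (torus R n)) = <<s @torus_open R n >> by [].
apply: (measurability _ mE) => _ [A [oA pA] <-].
rewrite setTI; apply: sub_sigma_algebra; split.
  by apply: open_comp => // x _; exact: cf.
by move=> x k /= Afx; have [k' ->] := pf x k; exact: pA.
Qed.

Lemma measurable_Tmap C : measurable_fun setT (@Tmap R n C).
Proof.
apply: measurable_torus_map; first exact: continuous_mulmx.
by move=> x k; exists (k *m C); rewrite /Tmap /intvec map_mxM -mulmxDl.
Qed.

Lemma measurable_translation t :
  measurable_fun setT ((fun x : 'rV[R]_n => x + t) : torus R n -> torus R n).
Proof.
apply: measurable_torus_map; last by move=> x k; exists k; rewrite addrAC.
by move=> x; exact: (continuousD (@cvg_id _ (nbhs x)) (@cst_continuous _ _ t x)).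
Qed.

(** The periodic sets form a sigma-algebra containing the generators. The proof uses an equivalence,
    because a single implication does not pass to complements. *)
Lemma measurable_Zn_periodic (F : set (torus R n)) : measurable F ->
  Zn_periodic (F : set 'rV[R]_n).
Proof.
suff : <<s @torus_open R n >> `<=` [set A | forall x k, A x <-> A (x + @intvec R n k)].
  by move=> h mF x k; apply: (h F mF x k).1.
apply: smallest_sub; last first.
  move=> A [_ pA] x k; split; first exact: pA.
  by move=> /(pA _ (- k)); rewrite /intvec map_mxN addrK.
split=> [x k|A pA x k|A pA x k].
- by split.
- by rewrite /= /setD/=; split=> -[_ nA]; split=> // Ax; apply: nA; apply/(pA x k).
- by split=> -[i _ Ai]; exists i => //; apply/(pA i x k).
Qed.

Definition cosv v (x : torus R n) : R := costurn (dot x v).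
Definition sinv v (x : torus R n) : R := sinturn (dot x v).

Lemma cosvD u v x : cosv (u + v) x = cosv u x * cosv v x - sinv u x * sinv v x.
Proof. by rewrite /cosv dotDr costurnD. Qed.

Lemma sinvD u v x : sinv (u + v) x = sinv u x * cosv v x + cosv u x * sinv v x.
Proof. by rewrite /sinv dotDr sinturnD. Qed.

Lemma cosvN v x : cosv (- v) x = cosv v x.
Proof. by rewrite /cosv dotNr costurnN. Qed.

Lemma sinvN v x : sinv (- v) x = - sinv v x.
Proof. by rewrite /sinv dotNr sinturnN. Qed.

Lemma cosv2Dsinv2 v x : cosv v x * cosv v x + sinv v x * sinv v x = 1.
Proof. by rewrite -!expr2; exact: cos2Dsin2. Qed.

Lemma bmf_cosv v : bounded_measurable (cosv v).
Proof.
split; last by exists 1 => x; exact: cos_max.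
apply: (@measurable_periodic (fun x => costurn (dot x v))).
  move=> x; apply: (@continuous_comp _ _ _ (dot^~ v) costurn); first exact: continuous_dot.
  exact: continuous_costurn.
by move=> x k; have [z zE] := dot_intvec k v; rewrite dotDl zE costurnDz.
Qed.

Lemma bmf_sinv v : bounded_measurable (sinv v).
Proof.
split; last by exists 1 => x; exact: sin_max.
apply: (@measurable_periodic (fun x => sinturn (dot x v))).
  move=> x; apply: (@continuous_comp _ _ _ (dot^~ v) sinturn); first exact: continuous_dot.
  exact: continuous_sinturn.
by move=> x k; have [z zE] := dot_intvec k v; rewrite dotDl zE sinturnDz.
Qed.

Lemma dot_iter C x v j : dot (iter j (@Tmap R n C) x) v = dot x ((C ^+ j) *m v).
Proof.
elim: j v => [|j IH] v; first by rewrite expr0 mul1mx.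
by rewrite iterS dot_Tmap IH mulmxA exprSr.
Qed.

End Torus.

Section Fourier.
Context {R : realType} {n : nat} (mu : probability (torus R n) R).
Variable A : 'M[int]_n.
Implicit Types (u v : 'cV[int]_n).
Local Notation T := (@Tmap R n A).
Local Notation E := (expect mu).
Local Notation intmx := (map_mx (fun z : int => z%:~R : R)).

Let mT : measurable_fun setT T := measurable_Tmap A.

Lemma expect_cosv_invariant (C : 'M[int]_n) v : timesC_invariant C mu ->
  E (cosv (C *m v)) = E (cosv v).
Proof.
move=> iC; rewrite -(expect_invariant (measurable_Tmap C) iC (bmf_cosv v)).
by congr expect; apply/funext => x; rewrite /cosv /= dot_Tmap.
Qed.

Lemma expect_sinv_invariant (C : 'M[int]_n) v : timesC_invariant C mu ->
  E (sinv (C *m v)) = E (sinv v).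
Proof.
move=> iC; rewrite -(expect_invariant (measurable_Tmap C) iC (bmf_sinv v)).
by congr expect; apply/funext => x; rewrite /sinv /= dot_Tmap.
Qed.

Let bc v := bmf_cosv v : bounded_measurable (@cosv R n v).
Let bs v := bmf_sinv v : bounded_measurable (@sinv R n v).

Lemma expect_cosv_shift j u v : E (cosv ((A ^+ j) *m v + u)) =
  corr mu T (cosv v) (cosv u) j - corr mu T (sinv v) (sinv u) j.
Proof.
rewrite /corr -expectB; [|exact: bmfM (bmf_iter mT _ (bc _)) (bc _)
                         |exact: bmfM (bmf_iter mT _ (bs _)) (bs _)].
by congr expect; apply/funext => x; rewrite cosvD /cosv /sinv !dot_iter.
Qed.

Lemma expect_sinv_shift j u v : E (sinv ((A ^+ j) *m v + u)) =
  corr mu T (sinv v) (cosv u) j + corr mu T (cosv v) (sinv u) j.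
Proof.
rewrite /corr -expectD; [|exact: bmfM (bmf_iter mT _ (bs _)) (bc _)
                         |exact: bmfM (bmf_iter mT _ (bc _)) (bs _)].
by congr expect; apply/funext => x; rewrite sinvD /cosv /sinv !dot_iter.
Qed.

(* L s c is a generalized notion of convergence of s to c for which the values
   of s on S determine c when they are constant. The L-limit of the relation
   muhat((A^j + B) v) = muhat(v), j in S, is muhat(v) muhat(B v) = muhat(v). *)
Lemma fourier_dichotomy (L : (nat -> R) -> R -> Prop) (S : set nat) (B : 'M[int]_n) v :
  (forall s t a b, L s a -> L t b -> L (fun j => s j + t j) (a + b)) ->
  (forall s t a b, L s a -> L t b -> L (fun j => s j - t j) (a - b)) ->
  (forall s c k, L s c -> (forall j, S j -> s j = k) -> c = k) ->
  (forall f g, bounded_measurable f -> bounded_measurable g ->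
     L (corr mu T f g) (E f * E g)) ->
  (forall j, S j -> timesC_invariant (A ^+ j + B) mu) ->
  E (cosv (B *m v)) = 1 \/ (E (cosv v) = 0 /\ E (sinv v) = 0).
Proof.
move=> LD LB Lcst Lcorr iS; set u := B *m v.
have := Lcst _ _ (E (cosv v)) (LB _ _ _ _ (Lcorr _ _ (bc v) (bc u)) (Lcorr _ _ (bs v) (bs u))).
have := Lcst _ _ (E (sinv v)) (LD _ _ _ _ (Lcorr _ _ (bs v) (bc u)) (Lcorr _ _ (bc v) (bs u))).
move=> /(_ _)-sE /(_ _)-cE.
have {}sE : E (sinv v) * E (cosv u) + E (cosv v) * E (sinv u) = E (sinv v).
  by apply: sE => j /iS ij; rewrite -expect_sinv_shift -mulmxDl expect_sinv_invariant.
have {}cE : E (cosv v) * E (cosv u) - E (sinv v) * E (sinv u) = E (cosv v).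
  by apply: cE => j /iS ij; rewrite -expect_cosv_shift -mulmxDl expect_cosv_invariant.
move: (E (cosv v)) (E (sinv v)) (E (cosv u)) (E (sinv u)) cE sE => a b c s cE sE.
(* The real part of conj(muhat v) (muhat(v) muhat(u) - muhat(v)); the imaginary part of muhat(u)
   drops out. *)
have : (c - 1) * (a * a + b * b) = 0.
  rewrite [LHS](_ : _ = a * (a * c - b * s - a) + b * (b * c + a * s - b)); last by ring.
  by rewrite cE sE !subrr !mulr0 addr0.
move/eqP; rewrite mulf_eq0 subr_eq0 => /orP[/eqP->|]; first by left.
rewrite -!expr2 paddr_eq0 ?sqr_ge0// !sqrf_eq0 => /andP[/eqP-> /eqP->].
by right.
Qed.

Lemma ae_dot_int v : E (cosv v) = 1 ->
  {ae mu, forall x : torus R n, exists z : int, dot x v = z%:~R}.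
Proof.
move=> E1; have b1 := bmf_cst (torus R n) (1 : R).
have : {ae mu, forall x : torus R n, 1 - cosv v x = 0}.
  apply: expect_eq0; first exact: bmfB.
    by move=> x; rewrite subr_ge0 cos_le1.
  by rewrite expectB// expect_cst E1 subrr.
by apply: filterS => x /eqP; rewrite subr_eq0 eq_sym => /eqP/costurn_eq1.
Qed.

(** A kernel vector of the transpose is a rational linear relation between the columns
    [B i *m v]. *)
Lemma strongly_independent_det (B : 'I_n -> 'M[int]_n) v :
  strongly_independent B -> v != 0 ->
  \det (\matrix_(r, i) (B i *m v) r 0) != 0.
Proof.
move=> iB v0; set W := (X in \det X); apply/negP => /eqP W0.
pose ratm := map_mx (fun z : int => z%:~R : rat).
have v0' : ratm _ _ v != 0.
  apply: contraNneq v0 => /matrixP v'0; apply/eqP/matrixP => i j.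
  by have := v'0 i j; rewrite !mxE => /eqP; rewrite intr_eq0 => /eqP.
have : \det (ratm _ _ W)^T == 0 by rewrite det_tr det_map_mx W0.
move/det0P => [c c0 cW]; case/negP: c0; apply/eqP/matrixP => i j.
rewrite ord1 mxE.
apply: (iB _ v0' (fun i => c 0 i)); apply/matrixP => r k.
rewrite ord1; have /matrixP/(_ 0 r) := cW; rewrite !mxE => <-.
rewrite summxE; apply: eq_bigr => l _; rewrite !mxE rmorph_sum/=; congr (_ * _).
by apply: eq_bigr => m _; rewrite !mxE rmorphM.
Qed.

(** Cramer's rule: [x] times the matrix of the columns [B i *m v] is almost surely an integer row,
    and multiplying by the adjugate leaves the determinant times [x]. *)
Lemma ae_torsion (B : 'I_n -> 'M[int]_n) v : strongly_independent B -> v != 0 ->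
  (forall i, E (cosv (B i *m v)) = 1) ->
  exists2 d : int, d != 0 & {ae mu, forall x : torus R n, exists k : 'rV[int]_n,
    d%:~R *: (x : 'rV[R]_n) = intmx k}.
Proof.
move=> iB v0 EB; have W0 := strongly_independent_det iB v0.
set W := (X in \det X) in W0; exists (\det W) => //.
have : {ae mu, forall x : torus R n, forall i, exists z : int, dot x (B i *m v) = z%:~R}.
  by apply: ae_forall_ord => i; exact: ae_dot_int.
apply: filterS => x /choice[z zE]; exists ((\row_i z i) *m \adj W).
have xW : (x : 'rV[R]_n) *m intmx W = intmx (\row_i z i).
  apply/matrixP => i j; rewrite ord1 !mxE -zE /dot !mxE.
  by apply: eq_bigr => l _; rewrite !mxE.
by rewrite map_mxM -xW -mulmxA -map_mxM mul_mx_adj map_scalar_mx mul_mx_scalar.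
Qed.

Lemma torsion_finitely_supported (d : int) : d != 0 ->
  {ae mu, forall x : torus R n, exists k : 'rV[int]_n, d%:~R *: (x : 'rV[R]_n) = intmx k} ->
  finitely_supported mu.
Proof.
move=> d0 aed.
(* Representatives of the points killed by [d]. The integer [d] may be negative, but remainders
   always lie between 0 and |d| - 1. *)
pose grid (r : 'rV['I_`|d|%N]_n) : 'rV[R]_n := \row_i ((r 0 i)%:R / d%:~R).
have dR0 : d%:~R != 0 :> R by rewrite intr_eq0.
(* Describing the hull by characters makes it measurable and lets the almost sure torsion be tested
   on coordinates. *)
have hullE : Zn_hull (range grid) =
    [set x | forall i, cosv (d *: delta_mx i 0) (x : torus R n) = 1].
  apply/seteqP; split=> [_ [_ [r _ <-]] [k _ <-] i|x xd].
    rewrite /cosv.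
    have -> : dot (grid r + @intvec R n k) (d *: delta_mx i 0) =
        ((r 0 i)%:Z + d * k 0 i)%:~R.
      rewrite /dot map_mxZ -scalemxAr mxE map_delta_mx.
      rewrite -colE !mxE intrD intrM mulrDr mulrC divfK//.
    exact: costurn_intr.
  have /choice[k kE] : forall i, exists z : int, d%:~R * x 0 i = z%:~R.
    move=> i; have [z zE] := costurn_eq1 (xd i); exists z; rewrite -zE.
    by rewrite /dot map_mxZ -scalemxAr mxE map_delta_mx -colE mxE.
  have lt_mod i : (`|(k i %% d)%Z|%N < `|d|%N)%N.
    by rewrite -ltz_nat gez0_abs ?modz_ge0// abszE ltz_mod.
  exists (grid (\row_i Ordinal (lt_mod i))); first by exists (\row_i Ordinal (lt_mod i)).
  exists (\row_i (k i %/ d)%Z) => //; apply/matrixP => i j; rewrite ord1 !mxE/=.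
  apply: (mulfI dR0); rewrite kE mulrDr mulrCA divff// mulr1 -intrM.
  by rewrite pmulrn gez0_abs ?modz_ge0// -intrD {3}(divz_eq (k j) d) mulrC addrC.
exists (range grid); split; first exact: finite_image.
rewrite hullE; apply: ae_prob1.
  rewrite [X in measurable X](_ : _ = \bigcap_(i in [set: 'I_n])
      (setT `&` cosv (d *: delta_mx i 0) @^-1` [set (1 : R)])).
    apply: fin_bigcap_measurable => // i _.
    by have [mc _] := @bmf_cosv R n (d *: delta_mx i 0); exact: mc.
  by apply/seteqP; split=> [x xd i _|x xd i]; [split=> //; exact: xd|exact: (xd i I).2].
apply: filterS aed => x [k kE] i; rewrite /cosv (_ : dot x _ = (k 0 i)%:~R) ?costurn_intr//.
rewrite /dot map_mxZ -scalemxAr mxE map_delta_mx -colE mxE.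
by have /matrixP/(_ 0 i) := kE; rewrite !mxE.
Qed.

End Fourier.

(** * Mixing measures carried by torsion points *)

Section Dirac.
Context {R : realType} {n : nat} (mu : probability (torus R n) R).
Variable A : 'M[int]_n.
Implicit Types (u v : 'cV[int]_n).
Local Notation T := (@Tmap R n A).
Local Notation E := (expect mu).
Local Notation intmx := (map_mx (fun z : int => z%:~R : R)).

Let bc v := bmf_cosv v : bounded_measurable (@cosv R n v).
Let bs v := bmf_sinv v : bounded_measurable (@sinv R n v).

(** The variance of the character v is 1 - |muhat(v)|^2: it bounds |muhat(v)| by 1, and in the case
    of equality the character is almost surely constant. *)
Lemma fourier_variance v :
  E (fun x => (cosv v x - E (cosv v)) * (cosv v x - E (cosv v)) +
              (sinv v x - E (sinv v)) * (sinv v x - E (sinv v))) =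
  1 - (E (cosv v) * E (cosv v) + E (sinv v) * E (sinv v)).
Proof.
set a := E (cosv v); set b := E (sinv v).
have -> : (fun x => (cosv v x - a) * (cosv v x - a) + (sinv v x - b) * (sinv v x - b)) =
    (fun x => (1 + (a * a + b * b)) - 2 * (a * cosv v x + b * sinv v x)).
  by apply/funext => x; rewrite -[X in X + (a * a + _)](cosv2Dsinv2 v x); ring.
have bl : bounded_measurable (fun x : torus R n => a * cosv v x + b * sinv v x).
  by apply: bmfD; exact: bmfZ.
rewrite expectB; [|exact: bmf_cst|exact: bmfZ].
rewrite expect_cst expectZ// expectD; [|exact: bmfZ..].
by rewrite !expectZ// -/a -/b; ring.
Qed.

Lemma fourier_le1 v : E (cosv v) * E (cosv v) + E (sinv v) * E (sinv v) <= 1.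
Proof.
rewrite -subr_ge0 -fourier_variance; apply: expect_ge0 => x.
by rewrite -!expr2 addr_ge0 ?sqr_ge0.
Qed.

Lemma ae_character_cst v :
  E (cosv v) * E (cosv v) + E (sinv v) * E (sinv v) = 1 ->
  {ae mu, forall x : torus R n, cosv v x = E (cosv v) /\ sinv v x = E (sinv v)}.
Proof.
move=> h; have bca : bounded_measurable (fun x : torus R n => cosv v x - E (cosv v)).
  by apply: bmfB => //; exact: bmf_cst.
have bsb : bounded_measurable (fun x : torus R n => sinv v x - E (sinv v)).
  by apply: bmfB => //; exact: bmf_cst.
have := @expect_eq0 _ _ _ mu _ (bmfD (bmfM bca bca) (bmfM bsb bsb)).
rewrite fourier_variance h subrr => /(_ _ erefl) h0.
apply: filterS (h0 _) => [x|x]; last by rewrite -!expr2 addr_ge0 ?sqr_ge0.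
by move/eqP; rewrite -!expr2 paddr_eq0 ?sqr_ge0// !sqrf_eq0 !subr_eq0 => /andP[/eqP? /eqP?].
Qed.

(* Modulo d, the vectors A^j v take finitely many values r, and a value r
   visited at time j makes the j-th correlation of the characters v and -r
   equal to 1; in the limit |muhat(v)| = 1. *)
Lemma torsion_dirac (d : int) (F : nat -> {fset nat}) : d != 0 ->
  {ae mu, forall x : torus R n, exists k : 'rV[int]_n,
     d%:~R *: (x : 'rV[R]_n) = intmx k} ->
  (forall m, F m != fset0) ->
  (forall f g, bounded_measurable f -> bounded_measurable g ->
     strong_cesaro_limit F (corr mu T f g) (E f * E g)) ->
  is_dirac mu.
Proof.
move=> d0 aed F0 mixF; have mT : measurable_fun setT T := measurable_Tmap A.
have modulus1 v : E (cosv v) * E (cosv v) + E (sinv v) * E (sinv v) = 1.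
  pose res (r : 'cV['I_`|d|%N]_n) : 'cV[int]_n := \col_i (r i 0 : nat)%:Z.
  have quo (w : 'cV[int]_n) : exists r q, w - res r = d *: q.
    have lt_mod i : (`|(w i 0%R %% d)%Z|%N < `|d|%N)%N.
      by rewrite -ltz_nat gez0_abs ?modz_ge0// abszE ltz_mod.
    exists (\col_i Ordinal (lt_mod i)), (\col_i (w i 0%R %/ d)%Z).
    apply/matrixP => i k; rewrite ord1 !mxE/= gez0_abs ?modz_ge0//.
    by apply/eqP; rewrite subr_eq [X in X == _](divz_eq (w i 0) d) mulrC.
  pose s r j := corr mu T (cosv v) (cosv (res r)) j + corr mu T (sinv v) (sinv (res r)) j.
  pose c r := E (cosv v) * E (cosv (res r)) + E (sinv v) * E (sinv (res r)).
  have [|j|r cr1] := @strong_cesaro_limit_finite R _ F s c F0.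
  - by move=> r; apply: strong_cesaro_limitD; exact: mixF.
  - have [r [q wE]] := quo (A ^+ j *m v); exists r.
    have -> : s r j = E (cosv (A ^+ j *m v - res r)).
      rewrite /s /corr -expectD; [|exact: bmfM (bmf_iter mT _ (bc _)) (bc _)
                         |exact: bmfM (bmf_iter mT _ (bs _)) (bs _)].
      congr expect; apply/funext => x.
      by rewrite cosvD cosvN sinvN mulrN opprK /cosv /sinv !dot_iter.
    rewrite -(expect_cst mu 1); apply: expect_ae => //; first exact: bmf_cst.
    apply: filterS aed => x [k kE]; rewrite wE /cosv.
    rewrite (_ : dot x _ = dot (d%:~R *: (x : 'rV[R]_n)) q).
      have [z zE] := dot_intvec k q : exists z : int, dot (@intvec R n k) _ = _.
      by rewrite kE -/(@intvec R n k) zE costurn_intr.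
    by rewrite /dot map_mxZ -scalemxAr -scalemxAl.
  (* Equality case of Cauchy-Schwarz: two vectors of the unit disc with scalar product 1 both have
     norm 1. *)
  have h1 := fourier_le1 v; have h2 := fourier_le1 (res r).
  rewrite /c in cr1; move: cr1 h1 h2.
  move: (E (cosv v)) (E (sinv v)) (E (cosv (res r))) (E (sinv (res r))) => a b a' b' e h1 h2.
  apply/eqP; rewrite eq_le h1/=.
  have := sqr_ge0 (a - a'); have := sqr_ge0 (b - b'); rewrite !expr2; lra.
(* The coordinate characters separate the points of the torus, so their almost sure values determine
   a single point. *)
have ae_cst : {ae mu, forall x : torus R n, forall i,
    cosv (delta_mx i 0) x = E (cosv (delta_mx i 0)) /\
    sinv (delta_mx i 0) x = E (sinv (delta_mx i 0))}.
  by apply: ae_forall_ord => i; exact: ae_character_cst.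
have [x0 x0E] := ae_exists ae_cst.
have ae_x0 : {ae mu, forall x : torus R n, exists k : 'rV[int]_n,
    (x : 'rV[R]_n) = (x0 : 'rV[R]_n) + @intvec R n k}.
  apply: filterS ae_cst => x xE.
  have /choice[k kE] : forall i, exists z : int,
      (x : 'rV[R]_n) 0 i - (x0 : 'rV[R]_n) 0 i = z%:~R.
    (* With equal cosines and sines at [x] and [x0], the cosine of the difference becomes cos^2 +
       sin^2 = 1. *)
    move=> i; apply: costurn_eq1; rewrite costurnD costurnN sinturnN mulrN opprK.
    have [cx sx] := xE i; have [cx0 sx0] := x0E i.
    have := cosv2Dsinv2 (delta_mx i 0) x.
    by rewrite {2}cx {2}sx -cx0 -sx0 /cosv /sinv !dot_delta.
  exists (\row_i k i); apply/matrixP => i j; rewrite ord1 !mxE -kE.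
  by rewrite addrC subrK.
exists x0 => G mG; have pG := measurable_Zn_periodic mG.
rewrite diracE; have [Gx0|nGx0] := pselect (G x0).
  rewrite mem_set//; apply: ae_prob1 => //.
  by apply: filterS ae_x0 => x [k ->]; exact: pG.
rewrite memNset//; apply: ae_prob0 => //.
apply: filterS ae_x0 => x [k ->] /(pG _ (- k)).
by rewrite /intvec map_mxN addrK.
Qed.

End Dirac.

(** * Uniqueness of the Haar measure *)

Section BoundedConvergence.
Context d (X : measurableType d) (R : realType) (P : probability X R).

Lemma expect_cvg (h : nat -> X -> R) (g : X -> R) (M : R) :
  (forall m, measurable_fun setT (h m)) -> (forall m x, `|h m x| <= M) ->
  (forall x, (fun m => h m x) @ \oo --> g x) ->
  bounded_measurable g /\ (fun m => expect P (h m)) @ \oo --> expect P g.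
Proof.
move=> mh hM hg.
have mg : measurable_fun setT g by apply: (measurable_fun_cvg mh) => x _; exact: hg.
have gM x : `|g x| <= M.
  have nhg : (fun m => `|h m x|) @ \oo --> `|g x| by apply: cvg_norm; exact: hg.
  rewrite -(cvg_lim (@Rhausdorff R) nhg).
  by apply: limr_le; [apply: cvgP nhg|apply: nearW => m; exact: hM].
split; first by split=> //; exists M.
have bh m : bounded_measurable (h m) by split=> //; exists M.
have [|||||_ _] := @dominated_convergence _ X R P setT measurableT
    (fun m x => (h m x)%:E) (EFin \o g) (cst M%:E).
- by move=> m; exact/measurable_EFinP.
- exact/measurable_EFinP.
- apply: aeW => x _; apply: cvg_EFin; first exact: nearW.
  exact: hg.
- by apply: (@bmf_integrable _ _ _ P (fun=> M)); exact: bmf_cst.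
- by apply: aeW => x m _; rewrite /= lee_fin.
- by rewrite /= -expectE; [move=> hc; exact: fine_cvg hc|split=> //; exists M].
Qed.

End BoundedConvergence.

Section StepPolynomial.
Context {R : realType}.

(* On [0, 1] these polynomials stay in [0, 1] and converge pointwise to the
   indicator of [0, 1/2): the first factor is the classical approximation,
   whose limit at 1/2 is not 0, and the second one vanishes there. *)
Definition step_poly (m : nat) (s : R) : R :=
  (1 - s ^+ m) ^+ (2 ^ m) * (1 - (1 - (2 * s - 1) ^+ 2) ^+ m).

Lemma step_poly_itv m s : 0 <= s <= 1 -> 0 <= step_poly m s <= 1.
Proof.
move=> /andP[s0 s1]; have sm : 0 <= 1 - s ^+ m <= 1.
  by rewrite subr_ge0 exprn_ile1//= gerBl exprn_ge0.
have q01 : 0 <= 1 - (2 * s - 1) ^+ 2 <= 1.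
  by rewrite gerBl sqr_ge0 andbT expr2; nra.
have qm : 0 <= 1 - (1 - (2 * s - 1) ^+ 2) ^+ m <= 1.
  move/andP: q01 => [q0 q1].
  by rewrite subr_ge0 exprn_ile1//= gerBl exprn_ge0.
move/andP: sm => [a0 a1]; move/andP: qm => [b0 b1].
by rewrite mulr_ge0 ?exprn_ge0//= mulr_ile1 ?exprn_ge0 ?exprn_ile1.
Qed.

Lemma bernoulli_ineq (y : R) N : 0 <= y <= 1 -> 1 - N%:R * y <= (1 - y) ^+ N.
Proof.
move=> /andP[y0 y1]; elim: N => [|N IH]; first by rewrite mul0r subr0 expr0.
rewrite exprS; apply: le_trans (ler_wpM2l _ IH); last by lra.
rewrite -natr1; have : 0 <= N%:R :> R by []; nra.
Qed.

(** Below 1/2, Bernoulli's inequality bounds the first factor below by 1 - (2s)^m. Above 1/2, that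
    factor is at most (2s)^-m. Away from 1/2 the second factor tends to 1 or is merely bounded by
    1. *)
Lemma step_poly_cvg s : 0 <= s <= 1 ->
  (fun m => step_poly m s) @ \oo --> ((s < 2^-1)%R%:R : R).
Proof.
move=> s01; have /andP[s0 s1] := s01.
have [slt|sgt|->] := ltrgtP s 2^-1.
- have h1 : (fun m => (1 - s ^+ m) ^+ (2 ^ m)) @ \oo --> (1 : R).
    have lim : (fun m => 1 - (2 * s) ^+ m) @ \oo --> (1 - 0 : R).
      apply: cvgB; first exact: cvg_cst.
      by apply: cvg_expr; rewrite ger0_norm ?mulr_ge0//; lra.
    rewrite subr0 in lim; apply: (squeeze_cvgr (h := fun=> (1 : R)) _ lim (cvg_cst (1 : R))).
    apply: nearW => m; apply/andP; split.
      have /(bernoulli_ineq (2 ^ m)) : 0 <= s ^+ m <= 1 by rewrite exprn_ge0// exprn_ile1.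
      by apply: le_trans; rewrite exprMn natrX.
    by rewrite exprn_ile1// ?subr_ge0 ?exprn_ile1// gerBl exprn_ge0.
  have h2 : (fun m => 1 - (1 - (2 * s - 1) ^+ 2) ^+ m) @ \oo --> (1 - 0 : R).
    apply: cvgB; first exact: cvg_cst.
    by apply: cvg_expr; rewrite ltr_norml; apply/andP; split; rewrite expr2; nra.
  have := cvgM h1 h2; rewrite subr0 mulr1; exact.
- have t1 : 1 < 2 * s by lra.
  have lim : (fun m => (2 * s)^-1 ^+ m) @ \oo --> (0 : R).
    by apply: cvg_expr; rewrite ger0_norm ?invr_ge0 ?invf_lt1; lra.
  apply: (squeeze_cvgr (f := fun=> 0) _ (cvg_cst 0) lim); apply: nearW => m.
  have /andP[-> _]/= := step_poly_itv m s01.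
  have sm0 : 0 <= s ^+ m by rewrite exprn_ge0.
  have sm1 : s ^+ m <= 1 by rewrite exprn_ile1.
  have q1 : 1 - (1 - (2 * s - 1) ^+ 2) ^+ m <= 1.
    by rewrite gerBl exprn_ge0// expr2; nra.
  have a0 : 0 <= (1 - s ^+ m) ^+ (2 ^ m) by rewrite exprn_ge0// subr_ge0.
  apply: (@le_trans _ _ ((1 - s ^+ m) ^+ (2 ^ m))); first exact: ler_piMr.
  rewrite exprVn -[leRHS]mul1r ler_pdivlMr ?exprn_gt0//; last by lra.
  (* The extra factor is at least (2s)^m by Bernoulli's inequality, and the product is (1 -
     s^2m)^(2^m), at most 1. *)
  apply: (@le_trans _ _ ((1 - s ^+ m) ^+ (2 ^ m) * (1 + s ^+ m) ^+ (2 ^ m))).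
    apply: ler_wpM2l => //; rewrite exprMn -natrX.
    apply: (@le_trans _ _ (1 + (2 ^ m)%:R * s ^+ m)); first by rewrite lerDr.
    elim: (2 ^ m)%N => [|N IH]; first by rewrite mul0r addr0 expr0.
    rewrite exprS; apply: le_trans (ler_wpM2l _ IH); last by lra.
    rewrite -natr1; have : 0 <= N%:R :> R by []; nra.
  rewrite -exprMn exprn_ile1//; nra.
- rewrite (_ : (fun m => _) = fun=> 0); first exact: cvg_cst.
  apply/funext => m; rewrite /step_poly mulfV// subrr expr2 mulr0 subr0 expr1n.
  by rewrite subrr mulr0.
Qed.

End StepPolynomial.

Section TrigonometricPolynomials.
Context {R : realType} {n : nat}.
Implicit Types (p q : torus R n -> R) (v : 'cV[int]_n).

(** The phase [c] covers sines as well as cosines, and a translation by t changes nothing but the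
    phases. *)
Inductive trigpoly : (torus R n -> R) -> Prop :=
| trig_cos a c v : trigpoly (fun x => a * costurn (dot x v + c))
| trig_add p q : trigpoly p -> trigpoly q -> trigpoly (fun x => p x + q x).

Lemma trigpoly_cst (a : R) : trigpoly (fun=> a).
Proof.
rewrite (_ : (fun=> a) = fun x => a * costurn (dot x 0 + 0)); first exact: trig_cos.
by apply/funext => x; rewrite dot0r addr0 /costurn mulr0 cos0 mulr1.
Qed.

Lemma trigpolyM p q : trigpoly p -> trigpoly q -> trigpoly (fun x => p x * q x).
Proof.
move=> hp hq; elim: hp q hq => {p} [a c v|p p' _ IH _ IH'] q hq; last first.
  rewrite (_ : (fun x => _) = fun x => p x * q x + p' x * q x).
    by apply: trig_add; [exact: IH|exact: IH'].
  by apply/funext => x; rewrite mulrDl.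
elim: hq => {q} [b e w|q q' _ IH _ IH']; last first.
  rewrite (_ : (fun x => _) = fun x => a * costurn (dot x v + c) * q x +
    a * costurn (dot x v + c) * q' x); first exact: trig_add.
  by apply/funext => x; rewrite mulrDr.
(* Product-to-sum formula. *)
rewrite (_ : (fun x => _) = fun x => a * b / 2 * costurn (dot x (v + w) + (c + e)) +
  a * b / 2 * costurn (dot x (v - w) + (c - e))).
  by apply: trig_add; exact: trig_cos.
apply/funext => x; rewrite !dotDr dotNr.
rewrite (_ : dot x v + dot x w + (c + e) = (dot x v + c) + (dot x w + e)); last by ring.
rewrite (_ : dot x v - dot x w + (c - e) = (dot x v + c) - (dot x w + e)); last by ring.
move: (dot x v + c) (dot x w + e) => s t.
by rewrite (costurnD s t) (costurnD s (- t)) costurnN sinturnN; field.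
Qed.

Lemma trigpolyB p q : trigpoly p -> trigpoly q -> trigpoly (fun x => p x - q x).
Proof.
move=> hp hq; rewrite (_ : (fun x => _) = fun x => p x + (- 1) * q x).
  by apply: trig_add => //; apply: trigpolyM => //; exact: trigpoly_cst.
by apply/funext => x; rewrite mulN1r.
Qed.

Lemma trigpolyX p m : trigpoly p -> trigpoly (fun x => p x ^+ m).
Proof.
move=> hp; elim: m => [|m IH]; first exact: (trigpoly_cst 1).
by under eq_fun do rewrite exprS; exact: trigpolyM.
Qed.

Lemma trigpoly_sum (I : Type) (r : seq I) (p : I -> torus R n -> R) :
  (forall i, trigpoly (p i)) -> trigpoly (fun x => \sum_(i <- r) p i x).
Proof.
move=> hp; elim: r => [|i r IH].
  by under eq_fun do rewrite big_nil; exact: trigpoly_cst.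
by under eq_fun do rewrite big_cons; exact: trig_add.
Qed.

Lemma trigpoly_prod (I : Type) (r : seq I) (p : I -> torus R n -> R) :
  (forall i, trigpoly (p i)) -> trigpoly (fun x => \prod_(i <- r) p i x).
Proof.
move=> hp; elim: r => [|i r IH].
  by under eq_fun do rewrite big_nil; exact: trigpoly_cst.
by under eq_fun do rewrite big_cons; exact: trigpolyM.
Qed.

Lemma trigpoly_step p m : trigpoly p -> trigpoly (fun x => step_poly m (p x)).
Proof.
move=> hp; have h1 := trigpoly_cst 1.
apply: trigpolyM; first exact/trigpolyX/trigpolyB/trigpolyX/hp.
apply: trigpolyB => //; apply: trigpolyX; apply: trigpolyB => //.
by apply: trigpolyX; apply: trigpolyB => //; apply: trigpolyM => //; exact: trigpoly_cst.
Qed.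

Lemma bmf_trigpoly p : trigpoly p -> bounded_measurable p.
Proof.
elim=> {p} [a c v|p q _ bp _ bq]; last exact: bmfD.
rewrite (_ : (fun x => _) = fun x => a * costurn c * cosv v x - a * sinturn c * sinv v x).
  by apply: bmfB; apply: bmfZ; [exact: bmf_cosv|exact: bmf_sinv].
by apply/funext => x; rewrite costurnD /cosv /sinv; ring.
Qed.

Definition translate (t : 'rV[R]_n) (x : torus R n) : torus R n := (x : 'rV[R]_n) + t.

(** Only the terms of frequency 0 have a nonzero expectation, and translation leaves them
    unchanged. *)
Lemma expect_trigpoly_translate (mu : probability (torus R n) R) p (t : 'rV[R]_n) :
  (forall v, v != 0 -> expect mu (cosv v) = 0 /\ expect mu (sinv v) = 0) ->
  trigpoly p -> expect mu (p \o translate t) = expect mu p.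
Proof.
move=> fourier0.
have expect_cos a c v : expect mu (fun x => a * costurn (dot x v + c)) =
    if v == 0 then a * costurn c else 0.
  have [->|v0] := eqVneq v 0.
    rewrite -[RHS](expect_cst mu); congr expect; apply/funext => x.
    by rewrite dot0r add0r.
  rewrite (_ : (fun x => _) = fun x => a * costurn c * cosv v x - a * sinturn c * sinv v x).
    rewrite expectB ?expectZ; [|exact: bmf_sinv|exact: bmf_cosv|
      exact/bmfZ/bmf_cosv|exact/bmfZ/bmf_sinv].
    by have [-> ->] := fourier0 v v0; rewrite !mulr0 subrr.
  by apply/funext => x; rewrite costurnD /cosv /sinv; ring.
elim=> {p} [a c v|p q hp IHp hq IHq].
  rewrite expect_cos.
  rewrite (_ : _ \o _ = fun x => a * costurn (dot x v + (dot t v + c))).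
    rewrite expect_cos; case: eqP => // ->; by rewrite dot0r add0r.
  by apply/funext => x; rewrite /= /translate dotDl addrA.
have mt := @measurable_translation R n t.
have bp := bmf_trigpoly hp; have bq := bmf_trigpoly hq.
rewrite (expectD mu bp bq) -IHp -IHq.
exact: (expectD mu (bmf_comp mt bp) (bmf_comp mt bq)).
Qed.

End TrigonometricPolynomials.

Section OpenCover.
Context {R : realType} {n : nat}.

(** The sum is a periodic substitute for the squared distance to [c]. Its threshold 1 / (k + 1) is
    moved to 1/2 and the scale 4 (n + 1) keeps the values in [0, 1], as [step_poly] requires.
    Rational centres and integer [k] make the family countable. *)
Definition torus_bump (c : 'rV[rat]_n) (k : nat) (x : torus R n) : R :=
  2^-1 + ((\sum_(i < n) (1 - costurn ((x : 'rV[R]_n) 0 i - ratr (c 0 i)))) - k.+1%:R^-1)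
    / (4 * n.+1%:R).

Lemma torus_bump_lt c k x : (torus_bump c k x < 2^-1) =
  (\sum_(i < n) (1 - costurn ((x : 'rV[R]_n) 0 i - ratr (c 0 i))) < k.+1%:R^-1).
Proof.
by rewrite /torus_bump gtrDl pmulr_llt0 ?invr_gt0 ?mulr_gt0// subr_lt0.
Qed.

Lemma torus_bump_itv c k x : 0 <= torus_bump c k x <= 1.
Proof.
rewrite /torus_bump; set S := \sum_(i < n) _.
have S0 : 0 <= S by apply: sumr_ge0 => i _; rewrite subr_ge0 cos_le1.
have S2 : S <= 2 * n.+1%:R.
  apply: (@le_trans _ _ (\sum_(i < n) 2)).
    have cos_ge t : 1 - costurn t <= 2 :> R.
      by have := cos_geN1 (pi *+ 2 * t); rewrite /costurn; lra.
    by apply: ler_sum => i _; exact: cos_ge.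
  by rewrite sumr_const card_ord -[2 *+ n]mulr_natr ler_wpM2l// ler_nat.
have k0 : 0 < k.+1%:R^-1 :> R by rewrite invr_gt0.
have k1 : k.+1%:R^-1 <= 1 :> R by rewrite invf_le1// ler1n.
have n1 : 1 <= n.+1%:R :> R by rewrite ler1n.
have D0 : 0 < 4 * n.+1%:R :> R by rewrite mulr_gt0.
rewrite -lerBlDl sub0r ler_pdivlMr// -lerBrDl ler_pdivrMr//.
move: S0 S2 k0 k1 n1; move: S k.+1%:R^-1 n.+1%:R => S K N S0 S2 k0 k1 n1.
by apply/andP; split; lra.
Qed.

Lemma trigpoly_torus_bump c k : trigpoly (torus_bump c k).
Proof.
have tc := @trigpoly_cst R n.
apply: trig_add => //; apply: trigpolyM => //; apply: trigpolyB => //.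
apply: trigpoly_sum => i; apply: trigpolyB => //.
rewrite (_ : (fun x => _) = fun x : torus R n =>
  1 * costurn (dot x (delta_mx i 0) + (- ratr (c 0 i)))); first exact: trig_cos.
by apply/funext => x; rewrite dot_delta mul1r.
Qed.

Lemma torus_open_bump_cover (O : set (torus R n)) : torus_open O ->
  forall x, O x -> exists c k, torus_bump c k x < 2^-1 /\
    (forall y, torus_bump c k y < 2^-1 -> O y).
Proof.
move=> [oO pO] x Ox.
have /nbhs_ballP[e0 /= e00 eO] : nbhs (x : 'rV[R]_n) O by exact: open_nbhs_nbhs.
pose e := Num.min e0 (2^-1).
have e_gt0 : 0 < e by rewrite lt_min e00/= invr_gt0.
have e_le : e <= 2^-1 by rewrite ge_min lexx orbT.
pose h := e / 2; have h0 : 0 < h by rewrite divr_gt0.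
have h1 : h < 2^-1 by rewrite /h; lra.
(* Equality would make [h] an integer strictly between 0 and 1. *)
have rho0 : 0 < 1 - costurn h.
  rewrite subr_gt0 lt_neqAle cos_le1 andbT; apply/eqP => /costurn_eq1[z hz].
  have z0 : 0 < z%:~R :> R by rewrite -hz.
  have z1 : z%:~R < 1 :> R by rewrite -hz; lra.
  by move: z0 z1; rewrite ltr0z ltrz1 gtz0_ge1 leNgt => /negbTE->.
(* A sum below 1 / (k + 1) then puts every coordinate of y - c within [h] of an integer. *)
pose k := Num.truncn (1 - costurn h)^-1.
have krho : k.+1%:R^-1 < 1 - costurn h.
  by rewrite -[ltRHS]invrK ltf_pV2 ?posrE ?invr_gt0// truncnS_gt.
have k0 : 0 < k.+1%:R^-1 / n.+1%:R :> R by rewrite divr_gt0 ?invr_gt0.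
have : \forall s \near (0 : R), `|costurn 0 - costurn s| < k.+1%:R^-1 / n.+1%:R.
  by have /cvgrPdist_lt := @continuous_costurn R 0; apply.
move=> /nbhs_ballP[d /= d0 dP].
(* Within [d] of the centre, the point [x] has a small bump value; within [h], the triangle
   inequality through the centre costs h + h = e at most. *)
pose w := Num.min d h; have w0 : 0 < w by rewrite lt_min d0 h0.
have /choice[c cP] : forall i : 'I_n, exists q : rat, `|(x : 'rV[R]_n) 0 i - ratr q| < w.
  move=> i; have [|q] := @rat_in_itvoo R ((x : 'rV[R]_n) 0 i - w) ((x : 'rV[R]_n) 0 i + w).
    by rewrite ltrD2l gtrN.
  by rewrite in_itv/= => /andP[q1 q2]; exists q; rewrite distrC ltr_distl q1.
exists (\row_i c i), k; split.
  rewrite torus_bump_lt; have [n0|n0] := posnP n.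
    by rewrite big1 ?invr_gt0// => i; have := ltn_ord i; rewrite {2}n0.
  apply: (@lt_le_trans _ _ (\sum_(i < n) (k.+1%:R^-1 / n.+1%:R))).
    apply: ltr_sum; first by apply/hasP; exists (Ordinal n0) => //; rewrite mem_index_enum.
    move=> i _; rewrite mxE; apply: le_lt_trans (dP ((x : 'rV[R]_n) 0 i - ratr (c i)) _).
      by rewrite (_ : costurn 0 = 1) ?ler_norm// -(costurn_intr 0).
    rewrite /ball/= sub0r normrN (lt_le_trans (cP i))//.
    by rewrite ge_min lexx.
  rewrite sumr_const card_ord -[_ *+ n]mulr_natr -mulrA ger_pMr ?invr_gt0//.
  by rewrite ler_pdivrMl// mulr1 ler_nat.
move=> y; rewrite torus_bump_lt => sum_lt.
have /choice[z zP] : forall i, exists z : int,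
    `|(y : 'rV[R]_n) 0 i - ratr (c i) - z%:~R| < h.
  move=> i; apply: costurn_gt => //.
  have : 1 - costurn ((y : 'rV[R]_n) 0 i - ratr (c i)) < 1 - costurn h.
    apply: le_lt_trans (lt_trans sum_lt krho).
    rewrite (bigD1 i)//= mxE lerDl sumr_ge0// => j _.
    by rewrite subr_ge0 cos_le1.
  by rewrite ltrD2l ltrN2.
have : O ((y : 'rV[R]_n) + @intvec R n (- \row_i z i)).
  apply: eO; split=> // i j; rewrite ord1 /ball/= !mxE.
  rewrite (_ : _ - _ = ((x : 'rV[R]_n) 0 j - ratr (c j)) -
      ((y : 'rV[R]_n) 0 j - ratr (c j) - (z j)%:~R)); last by rewrite intrN; ring.
  apply: (le_lt_trans (ler_normB _ _)).
  apply: (@lt_le_trans _ _ (h + h)).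
    by rewrite ltrD// (lt_le_trans (cP j))// ge_min lexx orbT.
  by rewrite /h -splitr ge_min lexx.
by move/(pO _ (\row_i z i)); rewrite /intvec map_mxN subrK.
Qed.

End OpenCover.

Section Haar.
Context {R : realType} {n : nat} (mu : probability (torus R n) R).
Hypothesis fourier0 : forall v : 'cV[int]_n, v != 0 ->
  expect mu (cosv v) = 0 /\ expect mu (sinv v) = 0.
Variable t : 'rV[R]_n.
Local Notation E := (expect mu).

Let mt := @measurable_translation R n t.

Let translation_fixed (h : torus R n -> R) :=
  bounded_measurable h /\ E (h \o translate t) = E h.

Let translation_fixed_lim (h : nat -> torus R n -> R) (g : torus R n -> R) (M : R) :
  (forall m, translation_fixed (h m)) -> (forall m x, `|h m x| <= M) ->
  (forall x, (fun m => h m x) @ \oo --> g x) -> translation_fixed g.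
Proof.
move=> fh hM hg.
have [bg lim1] := expect_cvg mu (fun m => (fh m).1.1) hM hg.
have [_ lim2] := @expect_cvg _ _ _ mu (fun m => h m \o translate t) (g \o translate t) M
  (fun m => measurableT_comp (fh m).1.1 mt) (fun m x => hM m _) (fun x => hg _).
split=> //.
have eqE : (fun m => E (h m \o translate t)) = (fun m => E (h m)).
  by apply/funext => m; exact: (fh m).2.
by move: lim2; rewrite eqE => lim2; exact: (cvg_unique _ lim2 lim1).
Qed.

Let cvg_prod (N : nat) (a : nat -> nat -> R) (l : nat -> R) :
  (forall k, (fun m => a k m) @ \oo --> l k) ->
  (fun m => \prod_(0 <= k < N) a k m) @ \oo --> \prod_(0 <= k < N) l k.
Proof.
move=> al; elim: N => [|N IH].
  rewrite big_geq// (_ : (fun m => _) = fun=> 1); first exact: cvg_cst.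
  by apply/funext => m; rewrite big_geq.
rewrite big_nat_recr//= (_ : (fun m => _) = (fun m => \prod_(0 <= k < N) a k m * a N m)).
  exact: (cvgM IH (al N)).
by apply/funext => m; rewrite big_nat_recr.
Qed.

Let prod_itv (N : nat) (a : nat -> R) : (forall k, 0 <= a k <= 1) ->
  0 <= \prod_(0 <= k < N) a k <= 1.
Proof.
move=> a01; elim: N => [|N /andP[p0 p1]]; first by rewrite big_geq// ler01 lexx.
rewrite big_nat_recr//=; have /andP[a0 a1] := a01 N.
by rewrite mulr_ge0//= mulr_ile1.
Qed.

(** An open set is the union of the countably many rational bump regions it contains. The limit in m
    turns trigonometric polynomials into indicators of finite unions of such regions, and the limit
    in N exhausts [O]. *)
Lemma expect_open_translate (O : set (torus R n)) : torus_open O ->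
  E (\1_O \o translate t) = E \1_O.
Proof.
move=> oO.
(* Codes that do not decode, and bumps whose region leaves [O], get the constant 1, which is never
   below 1/2 and adds nothing to the union. *)
pose f k : torus R n -> R :=
  if (choice.unpickle k : option ('rV[rat]_n * nat)%type) is Some (c, j) then
    if `[< forall y, @torus_bump R n c j y < 2^-1 -> O y >] then torus_bump c j else fun=> 1
  else fun=> 1.
have f_trig k : trigpoly (f k).
  rewrite /f; case: choice.unpickle => [[c j]|]; last exact: trigpoly_cst.
  by case: ifP => _; [exact: trigpoly_torus_bump|exact: trigpoly_cst].
have f_itv k x : 0 <= f k x <= 1.
  rewrite /f; case: choice.unpickle => [[c j]|]; last by rewrite ler01 lexx.
  by case: ifP => _; [exact: torus_bump_itv|rewrite ler01 lexx].
have half_lt1 : (1 < 2^-1 :> R) = false by apply/negbTE; rewrite -leNgt; lra.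
have f_O k x : f k x < 2^-1 -> O x.
  rewrite /f; case: choice.unpickle => [[c j]|]; last by rewrite half_lt1.
  by case: ifPn => [/asboolP|_]; [apply|rewrite half_lt1].
have O_f x : O x -> exists k, f k x < 2^-1.
  move=> Ox; have [c [j [xc cO]]] := torus_open_bump_cover oO Ox.
  by exists (choice.pickle (c, j)); rewrite /f choice.pickleK; case: asboolP.
pose b k x : R := (f k x < 2^-1)%R%:R.
pose g N x : R := 1 - \prod_(0 <= k < N) (1 - b k x).
have b_itv k x : 0 <= 1 - b k x <= 1.
  by rewrite /b; case: (_ < _); rewrite ?subrr ?subr0 lexx ler01.
have norm_itv (r : R) : 0 <= r <= 1 -> `|1 - r| <= 1.
  by move=> /andP[r0 r1]; rewrite ger0_norm ?subr_ge0// gerBl.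
have g_fixed N : translation_fixed (g N).
  pose h m x : R := 1 - \prod_(0 <= k < N) (1 - step_poly m (f k x)).
  have h_trig m : trigpoly (h m).
    have t1 := @trigpoly_cst R n 1; apply: trigpolyB => //.
    by apply: trigpoly_prod => k; apply: trigpolyB => //; exact: trigpoly_step.
  apply: (@translation_fixed_lim h (g N) 1) => [m|m x|x].
  - by split; [exact: bmf_trigpoly|exact: expect_trigpoly_translate].
  - apply/norm_itv/prod_itv => k; have /andP[s0 s1] := step_poly_itv m (f_itv k x).
    by rewrite subr_ge0 s1 gerBl.
  - have lim : (fun m => \prod_(0 <= k < N) (1 - step_poly m (f k x))) @ \oo -->
        \prod_(0 <= k < N) (1 - b k x).
      apply: (@cvg_prod N (fun k m => 1 - step_poly m (f k x)) (fun k => 1 - b k x)) => k.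
      exact: (cvgB (cvg_cst (1 : R)) (step_poly_cvg (f_itv k x))).
    exact: (cvgB (cvg_cst (1 : R)) lim).
suff : translation_fixed \1_O by case.
apply: (@translation_fixed_lim g _ 1) => // [N x|x].
  by apply/norm_itv/prod_itv.
have [Ox|nOx] := pselect (O x).
  have [k0 fk0] := O_f x Ox; rewrite indicE mem_set//.
  apply: cvg_near_cst; exists k0.+1 => // N /= kN.
  rewrite /g (bigD1_seq k0) ?mem_index_iota ?iota_uniq//=.
  by rewrite /b fk0 subrr mul0r subr0.
rewrite indicE memNset//; apply: cvg_near_cst; apply: nearW => N.
rewrite /g big1 ?subrr// => k _; rewrite /b.
by case: ltP => [/f_O//|_]; rewrite subr0.
Qed.

End Haar.

Section MainTheorem.
Context {R : realType} {n : nat} (mu : probability (torus R n) R).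

(** The image of [mu] under a translation agrees with [mu] on the torus-open sets, a generating
    class stable under intersection. *)
Lemma fourier0_is_haar :
  (forall v : 'cV[int]_n, v != 0 -> expect mu (cosv v) = 0 /\ expect mu (sinv v) = 0) ->
  is_haar mu.
Proof.
move=> fourier0 t F mF; have mt := @measurable_translation R n t.
pose m' := measure_function_pushforward__canonical__measure_function_Measure mu mt.
suff h G : measurable G -> m' G = mu G by exact: h.
have mE : (@measurable _ (torus R n)) = <<s @torus_open R n >> by [].
move=> mG.
refine (@measure_unique _ R (torus R n) (@torus_open R n) (fun=> setT) mE _ _ _ m' mu _ _ G mG).
- move=> A B [oA pA] [oB pB]; split; first exact: openI.
  by move=> x k [Ax Bx]; split; [exact: pA|exact: pB].
- by move=> _; split; [exact: openT|move=> ? ?].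
- exact: bigcup_const.
- move=> O oO; have mO : measurable (O : set (torus R n)) by exact: sub_sigma_algebra.
  have mpre : measurable (translate t @^-1` O).
    by rewrite -[_ @^-1` _]setTI; exact (mt measurableT O mO).
  have bO (A : set (torus R n)) := @bmf_indic _ (torus R n) R A.
  have preE : \1_O \o translate t = \1_(translate t @^-1` O) :> (torus R n -> R).
    by apply/funext => x; rewrite /= !indicE.
  have eqE := expect_open_translate fourier0 t oO; rewrite preE in eqE.
  have := congr1 EFin eqE; rewrite (expectE mu (bO _ mpre)) (expectE mu (bO _ mO)).
  by rewrite !integral_indic// !setIT.
- by move=> k; rewrite /= /pushforward preimage_setT probability_setT ltry.
Qed.

End MainTheorem.

(** * Strong mixing for bounded functions *)

Section SimpleApproximation.
Context d (X : measurableType d) (R : realType).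
Local Notation bmf := (@bounded_measurable d X R).
Implicit Types (f g h : X -> R).

Definition simple_fun (r : seq nat) (c : nat -> R) (A : nat -> set X) (x : X) : R :=
  \sum_(k <- r) c k * \1_(A k) x.

Lemma bmf_simple_fun r c A : (forall k, measurable (A k)) -> bmf (simple_fun r c A).
Proof.
move=> mA; rewrite /simple_fun; elim: r => [|k r IH].
  by under eq_fun do rewrite big_nil; exact: bmf_cst.
by under eq_fun do rewrite big_cons; apply: bmfD => //; exact/bmfZ/bmf_indic.
Qed.

(** The range is cut into slices of height [e]; on the slice where (f + M) / e lies in [k, k + 1)
    the approximant takes the lower value k e - M. *)
Lemma simple_fun_approx f (e : R) : bmf f -> 0 < e ->
  exists r c A, (forall k, measurable (A k)) /\
    forall x, `|f x - simple_fun r c A x| <= e.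
Proof.
move=> [mf [M fM]] e0.
pose A k := [set x | k%:R <= (f x + M) / e < k.+1%:R].
pose m := (Num.truncn ((M + M) / e)).+1.
have mfe : measurable_fun setT (fun x => (f x + M) / e).
  apply: measurable_funM; last exact: measurable_cst.
  by apply: measurable_funD => //; exact: measurable_cst.
exists (index_iota 0 m), (fun k => k%:R * e - M), A; split.
  move=> k; rewrite (_ : A k = setT `&` (fun x => (f x + M) / e) @^-1`
    `[k%:R, k.+1%:R[%classic).
    by apply: mfe => //; exact: measurable_itv.
  by apply/seteqP; split => x /=; rewrite in_itv/= ?setTI// => -[].
move=> x; have /andP[fM1 fM2] : - M <= f x <= M by rewrite -ler_norml.
pose y := (f x + M) / e; pose k := Num.truncn y.
have y0 : 0 <= y by rewrite divr_ge0 ?(ltW e0)// -lerBlDr sub0r.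
have /andP[ky yk] := Num.Theory.truncn_itv y0.
have km : (k < m)%N.
  rewrite ltnS /k; apply: Num.Theory.le_truncn.
  by rewrite ler_wpM2r ?invr_ge0 ?(ltW e0)// lerD2r.
rewrite /simple_fun (bigD1_seq k) ?mem_index_iota ?iota_uniq//= big1 ?addr0; last first.
  move=> l lk; rewrite indicE memNset ?mulr0// /A/= => /andP[ly yl].
  have : (l < k.+1)%N by rewrite -(ltr_nat R); exact: le_lt_trans ly yk.
  have : (k < l.+1)%N by rewrite -(ltr_nat R); exact: le_lt_trans ky yl.
  rewrite !ltnS => kl lk'; move/negP: lk; apply; apply/eqP/anti_leq.
  by rewrite lk'.
rewrite indicE mem_set ?mulr1; last by rewrite /A/= ky yk.
have -> : f x - (k%:R * e - M) = (y - k%:R) * e by rewrite /y mulrBl divfK ?gt_eqF//; ring.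
rewrite normrM (gtr0_norm e0) ger_pMl// ger0_norm ?subr_ge0//.
by rewrite lerBlDl -[1]/(1%:R) -natrD addn1 ltW.
Qed.

(** Linear functionals bounded by one multiple of the sup norm: convergence on indicators passes to
    simple functions, then to their uniform limits. *)
Lemma bounded_functional_cvg (F : nat -> (X -> R) -> R) (G : (X -> R) -> R) (C : R) :
  (forall j a f h, bmf f -> bmf h ->
     F j (fun x => a * f x + h x) = a * F j f + F j h) ->
  (forall a f h, bmf f -> bmf h ->
     G (fun x => a * f x + h x) = a * G f + G h) ->
  (forall j f e, bmf f -> (forall x, `|f x| <= e) -> `|F j f| <= C * e) ->
  (forall f e, bmf f -> (forall x, `|f x| <= e) -> `|G f| <= C * e) ->
  (forall A, measurable A -> (fun j => F j \1_A) @ \oo --> G \1_A) ->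
  forall f, bmf f -> (fun j => F j f) @ \oo --> G f.
Proof.
move=> Flin Glin Fb Gb FG f bf.
have b0 := bmf_cst X (0 : R).
have simple_cvg r c A : (forall k, measurable (A k)) ->
    (fun j => F j (simple_fun r c A)) @ \oo --> G (simple_fun r c A).
  move=> mA; elim: r => [|k r IH].
    have s0 : simple_fun [::] c A = fun=> 0.
      by apply/funext => x; rewrite /simple_fun big_nil.
    have zero (H : (X -> R) -> R) : (forall a f h, bmf f -> bmf h ->
        H (fun x => a * f x + h x) = a * H f + H h) -> H (fun=> 0) = 0.
      move=> Hlin; have := Hlin (-1) _ _ b0 b0.
      by under eq_fun do rewrite mulr0 addr0; rewrite mulN1r addNr.
    rewrite s0 zero// (_ : (fun j => _) = fun=> 0); first exact: cvg_cst.
    by apply/funext => j; apply: zero; exact: Flin.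
  have sS : simple_fun (k :: r) c A = fun x => c k * \1_(A k) x + simple_fun r c A x.
    by apply/funext => x; rewrite /simple_fun big_cons.
  have bS := bmf_simple_fun r c mA; have bI := bmf_indic R (mA k).
  rewrite sS Glin// (_ : (fun j => _) =
    fun j => c k * F j \1_(A k) + F j (simple_fun r c A)).
    exact: (cvgD (cvgM (cvg_cst (c k)) (FG _ (mA k))) IH).
  by apply/funext => j; exact: Flin.
apply/cvgrPdist_le => e e0.
have C0 : 0 <= C.
  have := Gb _ 1 b0 (fun x => _); rewrite mulr1 => Cge.
  by apply: (le_trans (normr_ge0 (G (fun=> 0)))); apply: Cge; rewrite normr0.
have d0 : 0 < e / 2 / (C + C + 1) by rewrite !divr_gt0//; lra.
have [r [c [A [mA fA]]]] := simple_fun_approx bf d0.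
set s := simple_fun r c A in fA; set dl := e / 2 / _ in d0 fA.
have bs : bmf s by exact: bmf_simple_fun.
have bfs : bmf (fun x => f x - s x) by exact: bmfB.
have fE : f = fun x => 1 * (f x - s x) + s x.
  by apply/funext => x; rewrite mul1r subrK.
have Csmall : C * dl + C * dl <= e / 2.
  rewrite -mulrDl /dl mulrA ler_pdivrMr; last by lra.
  by rewrite mulrC ler_wpM2l; lra.
have e20 : 0 < e / 2 by rewrite divr_gt0.
have /cvgrPdist_le/(_ _ e20) := simple_cvg r c A mA.
apply: filterS => j; rewrite -/s => sj.
have Ff : F j f = F j (fun x => f x - s x) + F j s.
  by rewrite {1}fE Flin// mul1r.
have Gf : G f = G (fun x => f x - s x) + G s by rewrite {1}fE Glin// mul1r.
rewrite Ff Gf (_ : _ - _ = (G (fun x => f x - s x) - F j (fun x => f x - s x)) +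
  (G s - F j s)); last by ring.
rewrite (splitr e) (le_trans (ler_normD _ _))// lerD//.
apply: le_trans Csmall; rewrite (le_trans (ler_normB _ _))// lerD//.
  exact: Gb.
exact: Fb.
Qed.

End SimpleApproximation.

Section StrongMixing.
Context d (X : measurableType d) (R : realType) (P : probability X R).
Variable T : X -> X.
Hypothesis mT : measurable_fun setT T.
Local Notation bmf := (@bounded_measurable d X R).

Lemma expect_indic (A : set X) : measurable A -> (expect P \1_A)%:E = P A.
Proof.
by move=> mA; rewrite (expectE P (bmf_indic R mA)) integral_indic// setIT.
Qed.

Lemma norm_expect_le (f : X -> R) (e : R) : bmf f -> (forall x, `|f x| <= e) ->
  `|expect P f| <= e.
Proof.
move=> bf fe; apply: (le_trans (ler_norm_expect P bf)).
by rewrite -(expect_cst P e); apply: ler_expect => //; [exact: bmf_norm|exact: bmf_cst].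
Qed.

(** Strong mixing is given on pairs of sets. Correlations are bilinear, so the extension to
    functions is made in one argument at a time. *)
Lemma strong_mixing_corr (f g : X -> R) : strongly_mixing P T -> bmf f -> bmf g ->
  (fun j => corr P T f g j) @ \oo --> expect P f * expect P g.
Proof.
move=> sT bf bg.
have indic_case A B : measurable A -> measurable B ->
    (fun j => corr P T \1_A \1_B j) @ \oo --> expect P \1_A * expect P \1_B.
  move=> mA mB; have := sT A B mA mB.
  have mAj j : measurable (iter j T @^-1` A `&` B).
    apply: measurableI => //; rewrite -[_ @^-1` _]setTI.
    exact: (measurable_iter j mT).
  rewrite -!expect_indic// -EFinM => h.
  rewrite (_ : (fun j => _) = fine \o (fun j => P (iter j T @^-1` A `&` B))).
    exact: fine_cvg h.
  apply/funext => j /=; rewrite -expect_indic//= /corr; congr expect.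
  by apply/funext => x; rewrite indicI /= !indicE.
have corr_lin1 u j a v w : bmf u -> bmf v -> bmf w ->
    corr P T (fun x => a * v x + w x) u j = a * corr P T v u j + corr P T w u j.
  move=> bu bv bw; have bvj := bmf_iter mT j bv; have bwj := bmf_iter mT j bw.
  rewrite /corr -expectZ; last exact: bmfM.
  rewrite -expectD; [|exact/bmfZ/bmfM|exact: bmfM].
  by congr expect; apply/funext => x; ring.
have corr_lin2 u j a v w : bmf u -> bmf v -> bmf w ->
    corr P T u (fun x => a * v x + w x) j = a * corr P T u v j + corr P T u w j.
  move=> bu bv bw; have buj := bmf_iter mT j bu.
  rewrite /corr -expectZ; last exact: bmfM.
  rewrite -expectD; [|exact/bmfZ/bmfM|exact: bmfM].
  by congr expect; apply/funext => x; ring.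
have expect_lin a v w : bmf v -> bmf w ->
    expect P (fun x => a * v x + w x) = a * expect P v + expect P w.
  by move=> bv bw; rewrite expectD ?expectZ//; exact: bmfZ.
have corr_le2 u v (M N : R) j : bmf u -> bmf v -> (forall x, `|u x| <= M) ->
    (forall x, `|v x| <= N) -> `|corr P T u v j| <= M * N.
  move=> bu bv uM vN; apply: norm_expect_le; first exact/bmfM/bv/bmf_iter.
  by move=> x; rewrite normrM ler_pM.
have step1 B : measurable B ->
    (fun j => corr P T f \1_B j) @ \oo --> expect P f * expect P \1_B.
  move=> mB; have bB := bmf_indic R mB.
  have B1 x : `|\1_B x : R| <= 1.
    by rewrite indicE; case: (_ \in _); rewrite ?normr1 ?normr0.
  apply: (bounded_functional_cvg (F := fun j f => corr P T f \1_B j)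
    (G := fun f => expect P f * expect P \1_B) (C := 1)) => //.
  - by move=> j a v w bv bw; exact: corr_lin1.
  - by move=> a v w bv bw; rewrite expect_lin//; ring.
  - by move=> j v e bv ve; rewrite mulrC; exact: corr_le2.
  - move=> v e bv ve; rewrite normrM mulrC ler_pM//; exact: norm_expect_le.
  - by move=> A mA; exact: indic_case.
have [_ [M fM]] := bf.
apply: (bounded_functional_cvg (F := fun j g => corr P T f g j)
    (G := fun g => expect P f * expect P g) (C := M)) => //.
- by move=> j a v w bv bw; exact: corr_lin2.
- by move=> a v w bv bw; rewrite expect_lin//; ring.
- by move=> j v e bv ve; exact: corr_le2.
- by move=> v e bv ve; rewrite normrM ler_pM//; exact: norm_expect_le.
Qed.

End StrongMixing.

(** * Classification *)

Section Classification.
Context {R : realType} {n : nat} (mu : probability (torus R n) R).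
Variable A : 'M[int]_n.
Local Notation T := (@Tmap R n A).
Local Notation E := (expect mu).

Let mT : measurable_fun setT T := measurable_Tmap A.

(** [L] is [cesaro_limit] in the ergodic case and [strong_cesaro_limit] in the two mixing cases. *)
Lemma haar_or_torsion (L : (nat -> R) -> R -> Prop) (S : set nat)
    (B : 'I_n -> 'M[int]_n) :
  (forall s t a b, L s a -> L t b -> L (fun j => s j + t j) (a + b)) ->
  (forall s t a b, L s a -> L t b -> L (fun j => s j - t j) (a - b)) ->
  (forall s c k, L s c -> (forall j, S j -> s j = k) -> c = k) ->
  (forall f g, bounded_measurable f -> bounded_measurable g ->
     L (corr mu T f g) (E f * E g)) ->
  strongly_independent B ->
  (forall j i, S j -> timesC_invariant (A ^+ j + B i) mu) ->
  is_haar mu \/ exists2 d : int, d != 0 &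
    {ae mu, forall x : torus R n, exists k : 'rV[int]_n,
       d%:~R *: (x : 'rV[R]_n) = map_mx (fun z : int => z%:~R : R) k}.
Proof.
move=> LD LB Lcst Lcorr iB iS.
have [fourier0|] := pselect (forall v : 'cV[int]_n, v != 0 ->
    E (cosv v) = 0 /\ E (sinv v) = 0).
  by left; exact: fourier0_is_haar.
move=> /existsNP[v /not_implyP[v0 nv]]; right.
apply: (ae_torsion iB v0) => i.
by have [] := fourier_dichotomy v LD LB Lcst Lcorr (fun j => iS j i).
Qed.

Lemma ergodic_haar_or_finitely_supported (B : 'I_n -> 'M[int]_n) (F : nat -> {fset nat})
    (S : set nat) :
  timesC_invariant A mu -> ergodic mu T ->
  strongly_independent B -> folner R F ->
  upper_density R F S = 1 ->
  (forall j i, S j -> timesC_invariant (A ^+ j + B i) mu) ->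
  is_haar mu \/ finitely_supported mu.
Proof.
move=> iA eT iB FF dS iS.
have [|||||] := @haar_or_torsion (cesaro_limit F) S B _ _ _ _ iB iS.
- exact: cesaro_limitD.
- exact: cesaro_limitB.
- by move=> s c k; apply: cesaro_limit_cst => //; case: FF.
- move=> f g bf bg; split; first exact: corr_bounded.
  exact: mean_ergodic.
- by left.
by case=> d d0 aed; right; exact: torsion_finitely_supported aed.
Qed.

(** Mixing along [F] is itself the hypothesis, so that [F] can be a Følner sequence for weak mixing
    and a sequence of singletons for strong mixing. *)
Lemma strong_cesaro_haar_or_dirac (B : 'I_n -> 'M[int]_n) (F : nat -> {fset nat})
    (S : set nat) :
  (forall m, F m != fset0) -> 0 < upper_density R F S ->
  (forall f g, bounded_measurable f -> bounded_measurable g ->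
     strong_cesaro_limit F (corr mu T f g) (E f * E g)) ->
  strongly_independent B ->
  (forall j i, S j -> timesC_invariant (A ^+ j + B i) mu) ->
  is_haar mu \/ (finitely_supported mu /\ is_dirac mu).
Proof.
move=> F0 dS mix iB iS.
have [||||] := @haar_or_torsion (strong_cesaro_limit F) S B _ _ _ mix iB iS.
- exact: strong_cesaro_limitD.
- exact: strong_cesaro_limitB.
- by move=> s c k; exact: strong_cesaro_limit_cst.
- by left.
case=> d d0 aed; right; split; first exact: torsion_finitely_supported aed.
exact: torsion_dirac aed F0 mix.
Qed.

Lemma average_fset1 (e : nat) (s : nat -> R) : average [fset e]%fset s = s e.
Proof. by rewrite /average big_seq_fset1 cardfs1 divr1. Qed.

Lemma strong_mixing_haar_or_dirac (B : 'I_n -> 'M[int]_n) (S : set nat) :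
  strongly_mixing mu T -> strongly_independent B -> infinite_set S ->
  (forall j i, S j -> timesC_invariant (A ^+ j + B i) mu) ->
  is_haar mu \/ (finitely_supported mu /\ is_dirac mu).
Proof.
move=> sT iB Sinf iS.
have /choice[e eP] m : exists j, (m <= j)%N /\ S j.
  by have [j mj Sj] := infinite_nat_unbounded Sinf m; exists j.
(* Averages over these singletons are values at indices of [S] tending to infinity: [S] has upper
   density 1 along [F], and ordinary limits become strong Cesàro limits. *)
pose F m : {fset nat} := [fset e m]%fset.
apply: (@strong_cesaro_haar_or_dirac B F S) => //.
- by move=> m; apply/fset0Pn; exists (e m); rewrite inE.
- rewrite /upper_density (_ : (fun m => _) = fun=> 1).
    have lim1 : (fun=> 1 : R) @ \oo --> (1 : R) by exact: cvg_cst.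
    by rewrite (cvg_limn_inf_sup lim1).2.
  apply/funext => m; rewrite density_average average_fset1 asboolT//.
  by case: (eP m).
- move=> f g bf bg; rewrite /strong_cesaro_limit.
  under eq_fun do rewrite average_fset1.
  have mix := strong_mixing_corr mT sT bf bg.
  have sq0 : (fun j => (corr mu T f g j - E f * E g) ^+ 2) @ \oo --> (0 : R).
    have d0 : (fun j => corr mu T f g j - E f * E g) @ \oo --> (0 : R).
      by rewrite -(subrr (E f * E g)); apply: cvgB => //; exact: cvg_cst.
    by rewrite -[0](mulr0 (0 : R)); exact: (cvgM d0 d0).
  apply: (cvg_comp e (fun j => (corr mu T f g j - E f * E g) ^+ 2)) sq0.
  move=> U [N _ NU]; exists N => // m /= Nm; apply: NU => /=.
  by apply: leq_trans Nm _; case: (eP m).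
Qed.

End Classification.

Theorem theorem1p7 (R : realType) (n : nat) (A : 'M[int]_n)
  (mu : probability (torus R n) R) :
  (0 < n)%N ->
  timesC_invariant A mu ->
  let cond1 :=
    ergodic mu (Tmap A) /\
    exists (B : 'I_n -> 'M[int]_n) (F : nat -> {fset nat}) (E : set nat),
      [/\ strongly_independent B, folner R F, upper_density R F E = 1 &
          forall j i, E j -> timesC_invariant (A ^+ j + B i) mu] in
  let cond2 :=
    weakly_mixing mu (Tmap A) /\
    exists (B : 'I_n -> 'M[int]_n) (F : nat -> {fset nat}) (E : set nat),
      [/\ strongly_independent B, folner R F, upper_density R F E > 0 &
          forall j i, E j -> timesC_invariant (A ^+ j + B i) mu] in
  let cond3 :=
    strongly_mixing mu (Tmap A) /\
    exists (B : 'I_n -> 'M[int]_n) (E : set nat),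
      [/\ strongly_independent B, infinite_set E &
          forall j i, E j -> timesC_invariant (A ^+ j + B i) mu] in
  ((cond1 \/ cond2 \/ cond3) -> finitely_supported mu \/ is_haar mu) /\
  ((cond2 \/ cond3) -> is_dirac mu \/ is_haar mu).
Proof.
move=> _ iA cond1 cond2 cond3.
have case1 : cond1 -> is_haar mu \/ finitely_supported mu.
  move=> [eT [B [F [E [iB FF dE iE]]]]].
  exact: ergodic_haar_or_finitely_supported iA eT iB FF dE iE.
have case23 : cond2 \/ cond3 -> is_haar mu \/ (finitely_supported mu /\ is_dirac mu).
  move=> [[wT [B [F [E [iB FF dE iE]]]]]|[sT [B [E [iB Einf iE]]]]].
    apply: (strong_cesaro_haar_or_dirac FF.1 dE _ iB iE) => f g bf bg.
    exact: (weak_mixing_square (measurable_Tmap A) iA wT FF bf bg).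
  exact: strong_mixing_haar_or_dirac sT iB Einf iE.
split=> [[/case1|/case23]|/case23].
- by case; [right|left].
- by case=> [|[]]; [right|left].
- by case=> [|[]]; [right|left].
Qed.
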